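(* Assume that H1 and H2(1) hold and that $\mathcal{K}\subset\Omega\times W^{1,\infty}$ is a positively $\Pi$-invariant compact set such that each one of its elements admits a backward extension in $\mathcal{K}$. Let $\pi_L$, $\widetilde\pi_L$, $C_0$, $\widehat C_r$, $\lambda_s^+$, $\lambda_{\mathcal{K}}$, $\widetilde\lambda_s^+$, $\widetilde\lambda_{\mathcal{K}}$ be as defined in the context. Then: (i) If $t\ge r$, then for every $(\omega,\bar x)\in\mathcal{K}$, $$\|\pi_L(t,\omega,\bar x)\|_{\mathrm{Lin}(W^{1,\infty},W^{1,\infty})}\le(1+C_0)\sup_{s\in[-r,0]}\|\widetilde\pi_L(t+s,\omega,\bar x)\|_{\mathrm{Lin}(C,C)}.$$ (ii) $\lambda_s^+(\omega,\bar x)\le\widetilde\lambda_s^+(\omega,\bar x)$ for every $(\omega,\bar x)\in\mathcal{K}$. (iii) If $t\ge r$, then for every $(\omega,\bar x)\in\mathcal{K}$, $$\|\widetilde\pi_L(t,\omega,\bar x)\|_{\mathrm{Lin}(C,C)}\le\widehat C_r\,\|\pi_L(t-r,\Pi(r,\omega,\bar x))\|_{\mathrm{Lin}(W^{1,\infty},W^{1,\infty})}.$$ (iv) $\widetilde\lambda_s^+(\omega,\bar x)\le\lambda_s^+(\Pi(r,\omega,\bar x))$ for every $(\omega,\bar x)\in\mathcal{K}$. (v) $\lambda_{\mathcal{K}}=\widetilde\lambda_{\mathcal{K}}$.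
   Context: Fix $r>0$ and $n\ge1$. $C=C([-r,0],\mathbb{R}^n)$ with the supremum norm $\|\cdot\|_C$; $W^{1,\infty}$ is the Banach space of Lipschitz functions $\psi:[-r,0]\to\mathbb{R}^n$ with norm $\|\psi\|_{W^{1,\infty}}=\max\{\|\psi\|_C,\|\dot\psi\|_{L^\infty}\}$. For a continuous function $y$ on $[t-r,t]$, $y_t(s)=y(t+s)$, $s\in[-r,0]$. $(\Omega,\sigma,\mathbb{R})$ is a continuous flow on a compact metric space, and $\omega\cdot t=\sigma(t,\omega)$. $\mathrm{Lin}(X,Y)$ is the space of bounded linear maps with the operator norm. Consider the family of equations, for $\omega\in\Omega$, $$\dot y(t)=F(\omega\cdot t,\,y(t),\,y(t-\tau(\omega\cdot t,y_t))),\quad t\ge0,$$ with $F:\Omega\times\mathbb{R}^n\times\mathbb{R}^n\to\mathbb{R}^n$ and $\tau:\Omega\times C\to[0,r]$. Conditions: H1: $F$ is continuous and its partial derivatives with respect to the second and third arguments exist and are continuous on $\Omega\times\mathbb{R}^n\times\mathbb{R}^n$. H2(1): $\tau$ is continuous and differentiable with respect to its second argument, with $D_2\tau:\Omega\times C\to\mathrm{Lin}(C,\mathbb{R})$ continuous. Under H1 and H2(1), for each $\omega\in\Omega$ and $x\in W^{1,\infty}$ there is a unique maximal solution $y(t,\omega,x)$ with $y(s,\omega,x)=x(s)$ for $s\in[-r,0]$, defined on $[-r,\beta_{\omega,x})$, $0<\beta_{\omega,x}\le\infty$. Put $u(t,\omega,x)(s)=y(t+s,\omega,x)$, which belongs to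 $W^{1,\infty}$, and $\Pi(t,\omega,x)=(\omega\cdot t,u(t,\omega,x))$ for $t\in[0,\beta_{\omega,x})$. A set $\mathcal{M}$ is positively $\Pi$-invariant if $\beta_{\omega,x}=\infty$ and $\Pi(t,\omega,x)\in\mathcal{M}$ for all $(\omega,x)\in\mathcal{M}$, $t\ge0$. A point $(\omega,x)\in\mathcal{M}$ admits a backward extension in $\mathcal{M}$ if there is a continuous $\theta:(-\infty,0]\to\mathcal{M}$ with $\theta(0)=(\omega,x)$ and $\Pi(t,\theta(s))=\theta(t+s)$ whenever $s\le-t\le0$. The existence of backward extensions implies that $\bar x$ is $C^1$ for all $(\omega,\bar x)\in\mathcal{K}$. For $(\omega,\bar x)\in\mathcal{K}$ and $\phi\in C$ define $$\begin{aligned}L(\omega,\bar x)\phi={}&D_2F(\omega,\bar x(0),\bar x(-\tau(\omega,\bar x)))\phi(0)+D_3F(\omega,\bar x(0),\bar x(-\tau(\omega,\bar x)))\phi(-\tau(\omega,\bar x))\\&-D_3F(\omega,\bar x(0),\bar x(-\tau(\omega,\bar x)))\,\dot{\bar x}(-\tau(\omega,\bar x))\cdot D_2\tau(\omega,\bar x)\phi .\end{aligned}$$ For $v\in C$ let $\widetilde z(t,\omega,\bar x,v)$, $t\ge-r$, be the solution of $\dot z(t)=L(\Pi(t,\omega,\bar x))z_t$, $t\ge0$, with $\widetilde z(s,\omega,\bar x,v)=v(s)$ for $s\in[-r,0]$, and for $t\ge0$ set $(\widetilde\pi_L(t,\omega,\bar x)v)(s)=\widetilde z(t+s,\omega,\bar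 x,v)$, $s\in[-r,0]$; this gives a bounded linear map $\widetilde\pi_L(t,\omega,\bar x):C\to C$. If $v\in W^{1,\infty}$ the same function belongs to $W^{1,\infty}$, and $\pi_L(t,\omega,\bar x):W^{1,\infty}\to W^{1,\infty}$ denotes the corresponding bounded linear map $v\mapsto\widetilde\pi_L(t,\omega,\bar x)v$. For $t\ge r$, $\widetilde\pi_L(t,\omega,\bar x)$ maps $C$ continuously into $W^{1,\infty}$; viewed as a map $C\to W^{1,\infty}$ it is denoted $\widehat\pi_L(t,\omega,\bar x)$. Constants (both finite): $$C_0=\sup_{(\omega,\bar x)\in\mathcal{K}}\|L(\omega,\bar x)\|_{\mathrm{Lin}(C,\mathbb{R}^n)},\qquad \widehat C_r=\sup_{(\omega,\bar x)\in\mathcal{K}}\|\widehat\pi_L(r,\omega,\bar x)\|_{\mathrm{Lin}(C,W^{1,\infty})}.$$ Upper Lyapunov exponents (with $\ln0=-\infty$): $$\lambda_s^+(\omega,\bar x)=\sup_{0\ne v\in W^{1,\infty}}\limsup_{t\to\infty}\tfrac1t\ln\|\pi_L(t,\omega,\bar x)v\|_{W^{1,\infty}},\quad \lambda_{\mathcal{K}}=\sup_{(\omega,\bar x)\in\mathcal{K}}\lambda_s^+(\omega,\bar x),$$ $$\widetilde\lambda_s^+(\omega,\bar x)=\sup_{0\ne v\in C}\limsup_{t\to\infty}\tfrac1t\ln\|\widetilde\pi_L(t,\omega,\bar x)v\|_{C},\quad \widetilde\lambda_{\mathcal{K}}=\sup_{(\omega,\bar x)\in\mathcal{K}}\widetilde\lambda_s^+(\omega,\bar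 x).$$ *)

(* Defs.v *)
From HB Require Import structures.
From mathcomp Require Import all_boot all_order all_algebra.
From mathcomp Require Import all_classical all_reals all_analysis.
From mathcomp Require Import ess_sup_inf lra.

Set Implicit Arguments.
Unset Strict Implicit.
Unset Printing Implicit Defensive.

Import Order.TTheory GRing.Theory Num.Theory.
Import numFieldNormedType.Exports.

Local Open Scope classical_set_scope.
Local Open Scope ring_scope.

(* The norm of R^n is arbitrary: [Rn N] is R^n normed by [N]. *)
Record rVnorm (R : realType) (n : nat) := RVnorm {
  rVnorm_fun :> 'rV[R]_n -> R ;
  rVnormD : forall x y, rVnorm_fun (x + y) <= rVnorm_fun x + rVnorm_fun y ;
  rVnormZ : forall (a : R) x, rVnorm_fun (a *: x) = `|a| * rVnorm_fun x ;
  rVnorm0_eq0 : forall x, rVnorm_fun x = 0 -> x = 0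
}.

Definition Rn (R : realType) (n : nat) (N : rVnorm R n) : Type := 'rV[R]_n.

HB.instance Definition _ (R : realType) n (N : rVnorm R n) :=
  GRing.Lmodule.copy (Rn N) 'rV[R]_n.
HB.instance Definition _ (R : realType) n (N : rVnorm R n) :=
  @Lmodule_isNormed.Build R (Rn N) N (rVnormD N) (rVnormZ N) (@rVnorm0_eq0 R n N).

(* C([-r, 0], E): the functions that are continuous on [-r, 0], represented by
   their extension by 0 outside of [-r, 0] so that equality is that of
   functions on [-r, 0]. *)
Section continuous_segments.
Context {R : realType} (r : R) (E : normedModType R).

Definition segC_pred : {pred R -> E} :=
  [pred x | `[< {within `[- r, 0], continuous x} /\
                 forall s, ~ `[- r, 0]%classic s -> x s = 0 >]].

Lemma segC_submod_closed : submod_closed segC_pred.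
Proof.
split=> [|a x y].
  rewrite inE; split => //.
  by move=> s; exact: cvg_cst.
move=> /asboolP[xc x0] /asboolP[yc y0]; apply/asboolP; split; last first.
  by move=> s sr; rewrite !fctE x0// y0// scaler0 addr0.
move=> s; apply: (@continuousD _ _ _ (fun u : subspace `[- r, 0] => a *: x u) y).
  by apply: continuousZl_tmp; exact: xc.
exact: yc.
Qed.

HB.instance Definition _ :=
  GRing.isSubmodClosed.Build R (R -> E) segC_pred segC_submod_closed.

Record segC := SegC { segC_fun :> R -> E ; _ : segC_fun \in segC_pred }.

HB.instance Definition _ := [isSub for segC_fun].
HB.instance Definition _ := [Choice of segC by <:].
HB.instance Definition _ := [SubChoice_isSubLmodule of segC by <:].

Lemma segC_within (x : segC) : {within `[- r, 0], continuous x}.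
Proof. by case: x => x /= /asboolP[]. Qed.

Lemma segC_out (x : segC) s : ~ `[- r, 0]%classic s -> x s = 0.
Proof. by case: x => x /= /asboolP[_]; exact. Qed.

Definition segC_norm (x : segC) : R := sup [set `|x s| | s in `[- r, 0]].

Lemma segC_bounded (x : segC) : has_ubound [set `|x s| | s in `[- r, 0]].
Proof.
have : compact [set x s | s in `[- r, 0]].
  by apply: continuous_compact; [exact: segC_within|exact: segment_compact].
move=> /compact_bounded[M [_ /(_ (M + 1))]].
rewrite ltrDl ltr01 => /(_ isT) H.
by exists (M + 1) => _ [s sr <-]; apply: H; exists s.
Qed.

Lemma segC_norm_ge (x : segC) s : `|x s| <= segC_norm x.
Proof.
have H u : `[- r, 0]%classic u -> `|x u| <= segC_norm x.
  by move=> ur; apply: ub_le_sup; [exact: segC_bounded|exists u].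
have [/H //|sr] := pselect (`[- r, 0]%classic s).
rewrite segC_out// normr0.
have [r0|r0] := leP 0 r.
  have := H 0; rewrite /= in_itv/= lexx oppr_le0 r0 => /(_ isT).
  exact: le_trans.
suff e : [set `|x s| | s in `[- r, 0]]%classic = set0 by rewrite /segC_norm e sup0.
apply/seteqP; split => // _ [u /= + _].
by rewrite in_itv/= => /andP[ru u0]; move: (le_trans ru u0); lra.
Qed.

Lemma segC_norm_le (x : segC) (M : R) :
  0 <= M -> (forall s, `[- r, 0]%classic s -> `|x s| <= M) -> segC_norm x <= M.
Proof.
move=> M0 xM.
have [ne|/nonemptyPn e] := pselect ([set `|x s| | s in `[- r, 0]]%classic !=set0).
  by apply: ge_sup => // _ [s sr <-]; exact: xM.
by rewrite /segC_norm e sup0.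
Qed.

Lemma segC_norm_ge0 (x : segC) : 0 <= segC_norm x.
Proof. exact: le_trans (segC_norm_ge x 0). Qed.

Lemma segC_normD (x y : segC) :
  segC_norm (x + y) <= segC_norm x + segC_norm y.
Proof.
apply: segC_norm_le => [|s _]; first by rewrite addr_ge0// segC_norm_ge0.
by rewrite (le_trans (ler_normD _ _))// lerD// segC_norm_ge.
Qed.

Lemma segC_norm_scale_le (a : R) (x : segC) :
  segC_norm (a *: x) <= `|a| * segC_norm x.
Proof.
apply: segC_norm_le => [|s _]; first by rewrite mulr_ge0// segC_norm_ge0.
by rewrite normrZ ler_wpM2l// segC_norm_ge.
Qed.

Lemma segC_normZ (a : R) (x : segC) :
  segC_norm (a *: x) = `|a| * segC_norm x.
Proof.
apply/eqP; rewrite eq_le segC_norm_scale_le/=.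
have [->|a0] := eqVneq a 0; first by rewrite normr0 mul0r segC_norm_ge0.
rewrite -ler_pdivlMl ?normr_gt0// -normfV.
by rewrite -[x in leLHS](scalerK a0) segC_norm_scale_le.
Qed.

Lemma segC_norm0_eq0 (x : segC) : segC_norm x = 0 -> x = 0.
Proof.
move=> x0; apply/val_inj/funext => s /=; apply/eqP.
by rewrite -normr_le0 -x0 segC_norm_ge.
Qed.

HB.instance Definition _ :=
  @Lmodule_isNormed.Build R segC segC_norm segC_normD segC_normZ segC_norm0_eq0.

(* Junk value 0 when [f] is not continuous on [-r, 0]. *)
Definition to_segC (f : R -> E) : segC := insubd 0 (patch (cst 0) `[- r, 0] f).

Definition segment (y : R -> E) (t : R) : segC := to_segC (fun s => y (t + s)).

End continuous_segments.

Section derivative_within.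
Context {R : realType} {E : normedModType R}.

(* One-sided at the endpoints when [A] is an interval. *)
Definition is_derive_within (A : set R) (f : R -> E) (s : R) (l : E) :=
  (u - s)^-1 *: (f u - f s) @[u --> within A s^'] --> l.

Definition derive_within (A : set R) (f : R -> E) (s : R) : E :=
  lim ((u - s)^-1 *: (f u - f s) @[u --> within A s^']).

End derivative_within.

Definition normE {R : realType} {V : normedModType R} (v : V) : \bar R :=
  `|v|%:E.

Section lipschitz_segments.
Context {R : realType} (r : R) (E : normedModType R).

Definition segW_pred : {pred segC r E} :=
  [pred x : segC r E | `[< exists k : R, k.-lipschitz_(`[- r, 0]) x >]].

Lemma segW_submod_closed : submod_closed segW_pred.
Proof.
split=> [|a x y /asboolP[k xk] /asboolP[l yl]]; apply/asboolP.
  by exists 0 => -[s u] _ /=; rewrite subrr normr0 mul0r.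
exists (`|a| * k + l) => -[s u] su /=.
rewrite !fctE opprD addrACA -scalerBr (le_trans (ler_normD _ _))//.
rewrite mulrDl lerD//; last exact: (yl (s, u)).
by rewrite normrZ -mulrA ler_wpM2l//; exact: (xk (s, u)).
Qed.

HB.instance Definition _ :=
  GRing.isSubmodClosed.Build R (segC r E) segW_pred segW_submod_closed.

Record segW := SegW { segW_val :> segC r E ; _ : segW_val \in segW_pred }.

HB.instance Definition _ := [isSub for segW_val].
HB.instance Definition _ := [Choice of segW by <:].
HB.instance Definition _ := [SubChoice_isSubLmodule of segW by <:].

(* A Lipschitz function is differentiable almost everywhere; the arbitrary value
   of [derive_within] at the other points does not affect the essential
   supremum. *)
Definition normW (x : segW) : \bar R :=
  maxe (normE (x : segC r E)) (ess_sup lebesgue_measure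
    (EFin \o patch (cst 0) `[- r, 0] (fun s => `|derive_within `[- r, 0] x s|))).

HB.instance Definition _ := isPointed.Build segW 0.

(* The topology of the norm [normW], generated by its open balls. *)
HB.instance Definition _ := isSubBaseTopological.Build segW
  [set: segW * R]%type
  (fun ce => [set x | (normW (x - ce.1)%R < ce.2%:E)%E]).

(* Junk value 0 when [x] is not Lipschitz. *)
Definition to_segW (x : segC r E) : segW := insubd 0 x.

End lipschitz_segments.
Arguments normW {R r E} x.

Section operator_norms.
Context {R : realType}.

(* The norm of Lin(V, U) for [V] normed by [NV] and [U] normed by [NU]. *)
Definition opnorm {V U : Type} (NV : V -> \bar R) (NU : U -> \bar R)
    (f : V -> U) : \bar R :=
  ereal_sup [set NU (f v) | v in [set v | (NV v <= 1)%E]].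

Definition continuous_Lin {T : topologicalType} {V U : normedModType R}
    (D : T -> V -> U) :=
  forall p0, opnorm normE normE (D p \- D p0) @[p --> p0] --> (0 : \bar R)%E.

(* sup over v != 0 of limsup (t -> +oo) of ln(NV (pi t v)) / t *)
Definition upper_lyapunov {V : zmodType} (NV : V -> \bar R)
    (pi : R -> V -> V) : \bar R :=
  ereal_sup [set limf_esup (fun t : R => (t^-1)%:E * lne (NV (pi t v)))%E
                           (pinfty_nbhs R)
            | v in [set v | v != 0]].

End operator_norms.

Section delay_equations.
Context {R : realType} {r : R} {E : normedModType R}.
Local Notation C := (segC r E).

(* y solves y'(t) = G(t, y_t), 0 <= t < T, with y = x on [-r, 0]; the
   derivative at t = 0 is the right one. *)
Definition dde_solution (G : R -> C -> E) (x : C) (T : \bar R) (y : R -> E) :=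
  [/\ (0 < T)%E,
      forall s, - r <= s <= 0 -> y s = x s,
      {within [set t : R | - r <= t /\ (t%:E < T)%E], continuous y} &
      forall t, 0 <= t -> (t%:E < T)%E ->
        is_derive_within [set u : R | 0 <= u /\ (u%:E < T)%E] y t
          (G t (segment r y t))].

(* y on [-r, T) is the unique maximal solution: it extends every solution. *)
Definition dde_maximal (G : R -> C -> E) (x : C) (T : \bar R) (y : R -> E) :=
  dde_solution G x T y /\
  forall T' y', dde_solution G x T' y' ->
    (T' <= T)%E /\ forall t, - r <= t -> (t%:E < T')%E -> y' t = y t.

End delay_equations.

Definition is_flow {R : realType} {Omega : topologicalType}
    (sigma : R -> Omega -> Omega) :=
  [/\ continuous (fun p : R * Omega => sigma p.1 p.2),
      forall w, sigma 0 w = w &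
      forall s t w, sigma (s + t) w = sigma s (sigma t w)].

Section state_dependent_delay.
Context {R : realType} {r : R} {E : normedModType R} {Omega : metricType R}.
Local Notation C := (segC r E).
Local Notation W := (segW r E).
Variables (sigma : R -> Omega -> Omega) (F : Omega -> E -> E -> E)
  (tau : Omega -> C -> R).

Definition D2F (w : Omega) (a b : E) : E -> E := 'd (fun a' => F w a' b) a.

Definition D3F (w : Omega) (a b : E) : E -> E := 'd (F w a) b.

Definition D2tau (w : Omega) (x : C) : C -> R := 'd (tau w) x.

Definition H1 :=
  [/\ continuous (fun p : Omega * E * E => F p.1.1 p.1.2 p.2),
      forall w a b, differentiable (fun a' => F w a' b) a,
      forall w a b, differentiable (F w a) b,
      continuous_Lin (fun p : Omega * E * E => D2F p.1.1 p.1.2 p.2) &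
      continuous_Lin (fun p : Omega * E * E => D3F p.1.1 p.1.2 p.2)].

Definition H2_1 :=
  [/\ continuous (fun p : Omega * C => tau p.1 p.2),
      forall w x, differentiable (tau w) x &
      continuous_Lin (fun p : Omega * C => D2tau p.1 p.2)].

Definition vector_field (w : Omega) (t : R) (phi : C) : E :=
  F (sigma t w) (phi 0) (phi (- tau (sigma t w) phi)).

(* The pair (beta, y(., w, x)); the junk value is never used since the maximal
   solution exists under H1 and H2_1. *)
Definition maximal_solution (w : Omega) (x : W) : (\bar R * (R -> E))%type :=
  xget (0%E, cst 0) [set Ty | dde_maximal (vector_field w) x Ty.1 Ty.2].

Definition beta (w : Omega) (x : W) : \bar R := (maximal_solution w x).1.

Definition sol (w : Omega) (x : W) : R -> E := (maximal_solution w x).2.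

Definition Pi (t : R) (p : Omega * W) : Omega * W :=
  (sigma t p.1, to_segW (segment r (sol p.1 p.2) t)).

Definition positively_invariant (M : set (Omega * W)) :=
  forall p, M p -> beta p.1 p.2 = +oo%E /\ forall t, 0 <= t -> M (Pi t p).

Definition backward_extension (M : set (Omega * W)) (p : Omega * W) :=
  exists theta : R -> Omega * W,
    [/\ {within [set s : R | s <= 0], continuous theta},
        forall s, s <= 0 -> M (theta s),
        theta 0 = p &
        forall s t, s <= - t -> - t <= 0 -> Pi t (theta s) = theta (t + s)].

Definition L (p : Omega * W) (phi : C) : E :=
  let: (w, x) := p in
  let d := tau w x in
  D2F w (x 0) (x (- d)) (phi 0) + D3F w (x 0) (x (- d)) (phi (- d))
  - D2tau w x phi *: D3F w (x 0) (x (- d)) (derive_within `[- r, 0] x (- d)).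

(* The solution on [-r, +oo) of z'(t) = L(Pi(t, p)) z_t; it exists, and the junk
   value is not used, when p belongs to a compact positively invariant set whose
   elements admit backward extensions. *)
Definition z_tilde (p : Omega * W) (v : C) : R -> E :=
  xget (cst 0) [set z | dde_maximal (fun t => L (Pi t p)) v +oo%E z].

Definition pi_tilde (t : R) (p : Omega * W) (v : C) : C :=
  segment r (z_tilde p v) t.

Definition pi_hat (t : R) (p : Omega * W) (v : C) : W :=
  to_segW (pi_tilde t p v).

Definition pi_L (t : R) (p : Omega * W) (v : W) : W :=
  to_segW (pi_tilde t p v).

Definition C0 (K : set (Omega * W)) : \bar R :=
  ereal_sup [set opnorm normE normE (L p) | p in K].

Definition hatC (K : set (Omega * W)) : \bar R :=
  ereal_sup [set opnorm normE normW (pi_hat r p) | p in K].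

Definition lambda_s (p : Omega * W) : \bar R :=
  upper_lyapunov normW (fun t => pi_L t p).

Definition lambda_tilde_s (p : Omega * W) : \bar R :=
  upper_lyapunov normE (fun t => pi_tilde t p).

Definition lambda (K : set (Omega * W)) : \bar R :=
  ereal_sup [set lambda_s p | p in K].

Definition lambda_tilde (K : set (Omega * W)) : \bar R :=
  ereal_sup [set lambda_tilde_s p | p in K].

End state_dependent_delay.

(* Main.v *)
Require Import Defs.
From HB Require Import structures.
From mathcomp Require Import all_boot all_order all_algebra.
From mathcomp Require Import all_classical all_reals all_analysis.
From mathcomp Require Import ess_sup_inf lra ring.

(** The derivative of a solution of the linearized equation at time t >= r is
    L(Pi(t, p)) applied to its segment, so the W^{1,oo}-norm of a segment is at
    most (1 + C0) times the supremum of the C-norms of the segments of the last r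
    units of time: this gives (i), and (ii) because a bounded factor and a bounded
    time window do not change exponential rates. Conversely pi_tilde(t, p) is
    pi_hat(r, p) followed by pi_L(t - r, Pi(r, p)), which gives (iii) and (iv),
    whence (v). The constant C0 is finite because K is compact and a backward
    extension exhibits every x in K as the segment at time r of a solution that
    stays in K, whose derivative is therefore a value of F on a compact set.

    No existence theorem is needed. On K the hypothesis beta = +oo already makes
    sol a maximal solution, and the cocycle identities follow from the maximality
    of solutions, by concatenation. Where the linearized problem has no maximal
    solution, z_tilde is 0, which is homogeneous and satisfies these identities. *)

Set Implicit Arguments.
Unset Strict Implicit.
Unset Printing Implicit Defensive.

Import Order.TTheory GRing.Theory Num.Theory.
Import numFieldNormedType.Exports.

Local Open Scope classical_set_scope.
Local Open Scope ring_scope.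

(** * One-variable calculus *)

Section one_variable_calculus.
Context {R : realType} {E : normedModType R}.
Implicit Types (A B : set R) (f g : R -> E) (a b d e s u M : R) (l : E).

Lemma continuous_withinP A f : {within A, continuous f} <->
  forall s, A s -> forall e, 0 < e ->
    exists2 d, 0 < d & forall u, A u -> `|u - s| < d -> `|f u - f s| <= e.
Proof.
split=> [/subspace_continuousP fc s As e e0|fc].
  move: (fc s As) => /cvgrPdist_le/(_ _ e0).
  move=> [d /= d0 sd]; exists d => // u Au usd.
  by rewrite distrC; apply: sd => //=; rewrite distrC.
apply/subspace_continuousP => s As; apply/cvgrPdist_le => e e0.
have [d d0 sd] := fc s As e e0; exists d => //= u /= usd Au.
by rewrite distrC; apply: sd => //; rewrite distrC.
Qed.

(** Multiplying out the difference quotient leaves an estimate that is trivial at [u = s], so the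
    punctured neighbourhood disappears. *)
Lemma is_derive_withinP A f s l : is_derive_within A f s l <->
  forall e, 0 < e -> exists2 d, 0 < d &
    forall u, A u -> `|u - s| < d -> `|f u - f s - (u - s) *: l| <= e * `|u - s|.
Proof.
have key u : u != s -> f u - f s - (u - s) *: l
    = - ((u - s) *: (l - (u - s)^-1 *: (f u - f s))).
  move=> us; rewrite scalerBr scalerA mulfV ?subr_eq0// scale1r.
  by rewrite opprB.
split=> [/cvgrPdist_le fl e e0|fl].
  have [d /= d0 sd] := fl e e0; exists d => // u Au usd.
  have [->|us] := eqVneq u s; first by rewrite !subrr scale0r subrr !normr0 mulr0.
  rewrite key// normrN normrZ mulrC ler_wpM2r//; apply: sd => //=.
  by rewrite distrC.
apply/cvgrPdist_le => e e0; have [d d0 sd] := fl e e0.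
exists d => //= u /= sud us Au; rewrite distrC in sud.
have := sd u Au sud; rewrite key// normrN normrZ mulrC ler_pM2r//.
by rewrite normr_gt0 subr_eq0.
Qed.

Lemma is_derive_within_scale A f s l a :
  is_derive_within A f s l -> is_derive_within A (fun u => a *: f u) s (a *: l).
Proof.
move=> /is_derive_withinP fl; apply/is_derive_withinP => e e0.
have a0 : 0 < `|a| + 1 by rewrite ltr_wpDl.
have [|d d0 fd] := fl (e / (`|a| + 1)); first by rewrite divr_gt0.
exists d => // u Au us; rewrite scalerA mulrC -scalerA -!scalerBr normrZ.
apply: (@le_trans _ _ ((`|a| + 1) * (e / (`|a| + 1) * `|u - s|))).
  by rewrite ler_pM ?fd// lerDl.
by rewrite mulrA mulrCA mulfV ?mulr1// gt_eqF.
Qed.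

(** Transports derivatives along time translations. Agreement is asked only near [s], so that it
    applies to functions glued from pieces. *)
Lemma is_derive_within_comp_shift A B f g s t l :
  (exists2 d, 0 < d & forall u, B u -> `|u - s| < d -> A (t + u) /\ g u = f (t + u)) ->
  g s = f (t + s) -> is_derive_within A f (t + s) l -> is_derive_within B g s l.
Proof.
move=> [d d0 gf] gs /is_derive_withinP fl; apply/is_derive_withinP => e e0.
have [d' d'0 sd] := fl e e0; exists (Num.min d d'); first by rewrite lt_min d0.
move=> u Bu; rewrite lt_min => /andP[ud ud'].
have [Atu ->] := gf u Bu ud; rewrite gs.
have -> : u - s = t + u - (t + s) by ring.
by apply: sd => //; have -> : t + u - (t + s) = u - s by ring.
Qed.

(** Uniqueness of the limit rests on properness of the filter: each point of a nondegenerate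
    interval is a limit of other points of it, from the right, or from the left at [b]. *)
Lemma derive_within_val a b f s l : a < b -> a <= s <= b ->
  is_derive_within `[a, b] f s l -> derive_within `[a, b] f s = l.
Proof.
move=> ab /andP[as_ sb] fl; rewrite /derive_within.
suff PF : ProperFilter (within `[a, b]%classic s^') by exact/cvg_lim.
apply: Build_ProperFilter_ex => P [d /= d0 sd].
have [sb'|bs] := ltP s b.
  pose u := s + Num.min (b - s) (d / 2).
  have u0 : 0 < Num.min (b - s) (d / 2) by rewrite lt_min subr_gt0 sb' divr_gt0.
  have u1 : Num.min (b - s) (d / 2) <= b - s by rewrite ge_min lexx.
  have u2 : Num.min (b - s) (d / 2) <= d / 2 by rewrite ge_min lexx orbT.
  exists u; apply: sd => /=; last by rewrite in_itv/= /u; apply/andP; split; lra.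
    by rewrite /u opprD addNKr normrN gtr0_norm//; lra.
  by rewrite gt_eqF// /u ltrDl.
pose u := s - Num.min (b - a) (d / 2).
have u0 : 0 < Num.min (b - a) (d / 2) by rewrite lt_min subr_gt0 ab divr_gt0.
have u1 : Num.min (b - a) (d / 2) <= b - a by rewrite ge_min lexx.
have u2 : Num.min (b - a) (d / 2) <= d / 2 by rewrite ge_min lexx orbT.
exists u; apply: sd => /=; last by rewrite in_itv/= /u; apply/andP; split; lra.
  by rewrite /u opprB addrC subrK gtr0_norm//; lra.
by rewrite lt_eqF// /u gtrDl oppr_lt0.
Qed.

(** Mean value inequality for vector values, proved with slope [M + e]: the slack [e] absorbs the
    first-order error of the derivative at each point. *)
Lemma derive_within_ler_dist A f (g : R -> E) M a b : a <= b ->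
  (forall s, a <= s <= b ->
     [/\ A s, is_derive_within A f s (g s) & `|g s| <= M]) ->
  `|f b - f a| <= M * (b - a).
Proof.
move=> ab fg; apply/ler_addgt0Pr => e0 e0_gt0.
(* The added 1 keeps the denominator positive when [b = a]; [e * (b - a) <= e0] still holds. *)
pose e := e0 / (b - a + 1).
have e_gt0 : 0 < e by rewrite divr_gt0// ltr_wpDl// subr_ge0.
suff : `|f b - f a| <= (M + e) * (b - a).
  move=> /le_trans; apply; rewrite mulrDl lerD2l /e -mulrA ger_pMr//.
  by rewrite mulrC ler_pdivrMr ?mul1r ?lerDl// ltr_wpDl// subr_ge0.
(* The infimum of the points where the bound fails is approached from below by
   points where it holds, and the derivative there propagates it upwards. *)
pose S := [set u | a <= u <= b /\ (M + e) * (u - a) < `|f u - f a|].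
rewrite leNgt; apply/negP => fail.
have Sb : S b by split => //; rewrite ab lexx.
have Sinf : has_inf S.
  by split; [exists b|exists a => u [/andP[]]].
set c := inf S.
have ac : a <= c by apply: lb_le_inf; [exists b|move=> u [/andP[]]].
have cb : c <= b by apply: ge_inf => //; case: Sinf.
have acb : a <= c <= b by rewrite ac.
have [_ /is_derive_withinP /(_ _ e_gt0)[d d0 fc] gc] := fg c acb.
have step u : a <= u <= b -> `|u - c| < d -> `|f u - f c| <= (M + e) * `|u - c|.
  move=> uab ucd; have [Au _ _] := fg u uab.
  rewrite -[f u - f c](subrK ((u - c) *: g c)) (le_trans (ler_normD _ _))//.
  rewrite mulrDl addrC lerD//; last exact: fc.
  by rewrite normrZ mulrC ler_wpM2r.
have good u : a <= u -> u < c -> `|f u - f a| <= (M + e) * (u - a).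
  move=> au uc; rewrite leNgt; apply/negP => bad.
  suff : c <= u by rewrite leNgt uc.
  apply: ge_inf; first by case: Sinf.
  by split => //; rewrite au (le_trans (ltW uc)).
have goodc : `|f c - f a| <= (M + e) * (c - a).
  have [->|ca] := eqVneq c a; first by rewrite !subrr normr0 mulr0.
  have ltac : a < c by rewrite lt_neqAle eq_sym ca.
  pose u := Num.max a (c - d / 2).
  have au : a <= u by rewrite le_max lexx.
  have uc : u < c by rewrite gt_max ltac/=; lra.
  have uc' : c - d / 2 <= u by rewrite le_max lexx orbT.
  have uE : `|u - c| = c - u by rewrite distrC gtr0_norm// subr_gt0.
  rewrite -[f c - f a](subrKA (f u)) (le_trans (ler_normD _ _))//.
  have -> : (M + e) * (c - a) = (M + e) * (c - u) + (M + e) * (u - a) by ring.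
  rewrite lerD ?good// distrC -uE step// ?au/= ?(le_trans (ltW uc))//.
  by rewrite uE; lra.
have [v [/andP[av vb] fv] vc] := inf_adherent d0 Sinf.
have cv : c <= v by apply: ge_inf; [case: Sinf|split => //; rewrite av].
move: fv; rewrite ltNge => /negP; apply.
rewrite -[f v - f a](subrKA (f c)) (le_trans (ler_normD _ _))//.
have -> : (M + e) * (v - a) = (M + e) * (v - c) + (M + e) * (c - a) by ring.
have vE : `|v - c| = v - c by rewrite ger0_norm// subr_ge0.
by rewrite lerD// -vE step ?av// vE ltrBlDl.
Qed.

End one_variable_calculus.

(** * Segments and delay equations *)

Section segments.
Context {R : realType} {r : R} {E : normedModType R}.
Implicit Types (x : segC r E) (y : R -> E) (s t : R) (A : set R).

Lemma segC_ext x x' : (forall s, - r <= s <= 0 -> x s = x' s) -> x = x'.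
Proof.
move=> xx'; apply/val_inj/funext => s /=.
have [sr|sr] := pselect (`[- r, 0]%classic s); last by rewrite !segC_out.
by apply: xx'; move: sr; rewrite /= in_itv.
Qed.

(** Continuity of [y] on [A] makes the patched translate a member of [segC_pred], so [to_segC] does
    not return its junk value. *)
Lemma segmentE A y t s : {within A, continuous y} ->
  (forall u, - r <= u <= 0 -> A (t + u)) -> - r <= s <= 0 ->
  segment r y t s = y (t + s).
Proof.
move=> /continuous_withinP yc At sr.
have rP u : `[- r, 0]%classic u = (- r <= u <= 0) :> Prop by rewrite /= in_itv.
have pE u : - r <= u <= 0 ->
    patch (cst 0) `[- r, 0] (fun u => y (t + u)) u = y (t + u).
  by move=> ur; rewrite /patch mem_set// rP.
rewrite /segment /to_segC insubdK ?pE//.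
apply/asboolP; split=> [|u ur]; last by rewrite /patch memNset.
apply/continuous_withinP => u; rewrite rP => ur e e0.
have [d d0 yd] := yc _ (At _ ur) e e0; exists d => // v; rewrite rP => vr vu.
rewrite !pE//; apply: yd; first exact: At.
by have -> : t + v - (t + u) = v - u by ring.
Qed.

(** The two patched functions coincide, so both sides take the same branch of [insubd], junk or
    not. *)
Lemma segment_ext y y' t t' :
  (forall s, - r <= s <= 0 -> y (t + s) = y' (t' + s)) ->
  segment r y t = segment r y' t'.
Proof.
move=> yy'; rewrite /segment /to_segC; congr insubd; apply/funext => s.
rewrite /patch; case: ifPn => // /set_mem/=; rewrite in_itv/=.
exact: yy'.
Qed.

Lemma segment_cst0 t : segment r (cst (0 : E)) t = 0.
Proof.
apply: segC_ext => s sr; rewrite (@segmentE setT)//.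
by move=> ?; exact: cvg_cst.
Qed.

Lemma segment_init x y : (forall s, - r <= s <= 0 -> y s = x s) ->
  segment r y 0 = x.
Proof.
move=> yx; apply/val_inj => /=.
have pE : patch (cst 0) `[- r, 0] (fun u => y (0 + u)) = x.
  apply/funext => s; rewrite /patch; case: ifPn => [/set_mem/=|/negP sr].
    by rewrite in_itv/= add0r => /yx.
  by rewrite segC_out// => sr'; apply: sr; rewrite inE.
rewrite /segment /to_segC insubdK pE//; exact: valP.
Qed.

Lemma segment_scale A y t a : {within A, continuous y} ->
  (forall u, - r <= u <= 0 -> A (t + u)) ->
  segment r (fun u => a *: y u) t = a *: segment r y t.
Proof.
move=> yc At; apply: segC_ext => s sr.
have ayc : {within A, continuous (fun u => a *: y u)}.
  by move=> u; apply: continuousZl_tmp; exact: yc.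
by rewrite (segmentE ayc)// -[RHS]/(a *: segment r y t s) (segmentE yc).
Qed.

Lemma segment_lipschitz y t a b k : 0 < r -> a <= t - r -> t <= b ->
  k.-lipschitz_(`[a, b]) y -> segment r y t \in @segW_pred R r E.
Proof.
move=> r0 atr tb yk.
have ab s : - r <= s <= 0 -> `[a, b]%classic (t + s).
  by move=> /andP[rs s0]; rewrite /= in_itv/=; apply/andP; split; lra.
have yc : {within `[a, b], continuous y}.
  apply/continuous_withinP => s sab e e0.
  (* The constant [k] may be zero or negative; |k| + 1 is a positive Lipschitz constant by which one
     can divide. *)
  have k0 : 0 < `|k| + 1 by rewrite ltr_wpDl.
  exists (e / (`|k| + 1)); first by rewrite divr_gt0.
  move=> u uab; rewrite ltr_pdivlMr// mulrC => us.
  apply: le_trans (ltW us); apply: le_trans (yk (u, s) (conj uab sab)) _ => /=.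
  by rewrite ler_wpM2r// (le_trans (ler_norm _))// lerDl.
apply/asboolP; exists k => -[u v] [/= ur vr].
rewrite !in_itv/= in ur vr.
rewrite !(segmentE yc)//.
have := yk (t + u, t + v) (conj (ab _ ur) (ab _ vr)) => /=.
by have -> : t + u - (t + v) = u - v by ring.
Qed.

End segments.

(** Pairs that straddle [b] are split there. This glues a Lipschitz initial segment to the solution
    that continues it. *)
Lemma lipschitz_itv_cat (R : realType) (E : normedModType R) (f : R -> E)
    (a b c k l : R) :
  a <= b -> b <= c -> k.-lipschitz_(`[a, b]) f -> l.-lipschitz_(`[b, c]) f ->
  (Num.max k l).-lipschitz_(`[a, c]) f.
Proof.
move=> ab bc fk fl.
have kP u v : a <= u -> u <= v -> v <= b -> `|f v - f u| <= Num.max k l * (v - u).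
  move=> au uv vb.
  have := fk (v, u); rewrite /= ger0_norm ?subr_ge0// => H.
  apply: le_trans (H _) _; last by rewrite ler_wpM2r ?subr_ge0// le_max lexx.
  by split; rewrite /= in_itv/=; apply/andP; split => //; lra.
have lP u v : b <= u -> u <= v -> v <= c -> `|f v - f u| <= Num.max k l * (v - u).
  move=> au uv vb.
  have := fl (v, u); rewrite /= ger0_norm ?subr_ge0// => H.
  apply: le_trans (H _) _; last by rewrite ler_wpM2r ?subr_ge0// le_max lexx orbT.
  by split; rewrite /= in_itv/=; apply/andP; split => //; lra.
have klP u v : a <= u -> u <= v -> v <= c -> `|f v - f u| <= Num.max k l * (v - u).
  move=> au uv vc.
  have [vb|bv] := leP v b; first exact: kP.
  have [bu|ub] := leP b u; first exact: lP.
  rewrite -[f v - f u](subrKA (f b)) (le_trans (ler_normD _ _))//.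
  have -> : Num.max k l * (v - u)
    = Num.max k l * (v - b) + Num.max k l * (b - u) by ring.
  by apply: lerD; [apply: lP => //; exact: ltW|apply: kP => //; exact: ltW].
move=> [u v] [/=]; rewrite !in_itv/= => /andP[au uc] /andP[av vc].
have [uv|vu] := leP u v.
  by rewrite distrC [`|u - v|]distrC ger0_norm ?subr_ge0// klP.
by rewrite [`|u - v|]ger0_norm ?klP// ?subr_ge0; exact: ltW.
Qed.

(** * Delay equations: scaling, translation and concatenation of solutions *)

Section dde.
Context {R : realType} {r : R} {E : normedModType R}.
Implicit Types (x : segC r E) (y : R -> E) (s t a : R) (T : \bar R)
  (G : R -> segC r E -> E).

Lemma dde_segmentE G x T y t s : dde_solution G x T y ->
  0 <= t -> (t%:E < T)%E -> - r <= s <= 0 -> segment r y t s = y (t + s).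
Proof.
move=> [_ _ yc _] t0 tT; apply: segmentE yc _ => u /andP[ru u0]; split; first lra.
by apply: le_lt_trans tT; rewrite lee_fin; lra.
Qed.

Lemma dde_segment_scale G x T y t a : dde_solution G x T y ->
  0 <= t -> (t%:E < T)%E ->
  segment r (fun u => a *: y u) t = a *: segment r y t.
Proof.
move=> [_ _ yc _] t0 tT; apply: segment_scale yc _ => u /andP[ru u0].
by split; [lra|apply: le_lt_trans tT; rewrite lee_fin; lra].
Qed.

Lemma dde_solution_scale G x T y a :
  (forall t c phi, 0 <= t -> G t (c *: phi) = c *: G t phi) ->
  dde_solution G x T y -> dde_solution G (a *: x) T (fun t => a *: y t).
Proof.
move=> GZ ysol; case: (ysol) => T0 yx yc yd; split => //.
- by move=> s sr; rewrite yx.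
- by move=> u; apply: continuousZl_tmp; exact: yc.
- move=> t t0 tT; rewrite (dde_segment_scale _ ysol)// GZ//.
  by apply: is_derive_within_scale; exact: yd.
Qed.

Lemma dde_solution0 G :
  (forall t c phi, 0 <= t -> G t (c *: phi) = c *: G t phi) ->
  dde_solution G 0 +oo%E (cst 0).
Proof.
move=> GZ; split => //; first by move=> ?; exact: cvg_cst.
move=> t t0 _.
rewrite segment_cst0 -(scale0r (0 : segC r E)) GZ// scale0r.
apply/is_derive_withinP => e e0; exists 1 => // u _ _.
by rewrite scaler0 !subrr normr0 mulr_ge0// ltW.
Qed.

(** A competitor starting from [a *: x] is scaled back by the inverse of [a] to a competitor
    starting from [x]. *)
Lemma dde_maximal_scale G x y a : a != 0 ->
  (forall t c phi, 0 <= t -> G t (c *: phi) = c *: G t phi) ->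
  dde_maximal G x +oo%E y -> dde_maximal G (a *: x) +oo%E (fun t => a *: y t).
Proof.
move=> a0 GZ [ysol ymax]; split; first exact: dde_solution_scale.
move=> T' y' /(dde_solution_scale a^-1 GZ).
rewrite scalerK// => /ymax[T'T y'y]; split => // t rt tT'.
by rewrite -y'y// scalerKV.
Qed.

Lemma dde_solution_shift G x y s : 0 <= s -> dde_solution G x +oo%E y ->
  dde_solution (fun t => G (s + t)) (segment r y s) +oo%E (fun t => y (s + t)).
Proof.
move=> s0 ysol; case: (ysol) => _ yx /continuous_withinP yc yd; split => //.
- by move=> u ur; rewrite (dde_segmentE ysol) ?ltry.
- apply/continuous_withinP => u [ru _] e e0.
  have [|d d0 yde] := yc (s + u) _ e e0; first by split; [lra|exact: ltry].
  exists d => // v [rv _] vu; apply: yde; first by split; [lra|exact: ltry].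
  by have -> : s + v - (s + u) = v - u by ring.
- move=> t t0 _.
  rewrite (_ : segment r _ t = segment r y (s + t)); last first.
    by apply: segment_ext => u _; rewrite addrA.
  apply: is_derive_within_comp_shift; [|by []|apply: yd; [lra|exact: ltry]].
  by exists 1 => // u [u0 _] _; split => //; split; [lra|exact: ltry].
Qed.

(** On the overlap [[s - r, s]] both formulas agree, since [y'] starts from the segment of [y] at
    [s]. Hence every segment of the glued function is a segment of [y] or of [y']. *)
Lemma dde_solution_concat G x y s T' y' : 0 < r -> 0 <= s -> dde_solution G x +oo%E y ->
  dde_solution (fun t => G (s + t)) (segment r y s) T' y' ->
  dde_solution G x (T' + s%:E) (fun u => if u <= s then y u else y' (u - s)).
Proof.
move=> r_gt0 s0 ysol y'sol; pose Y u := if u <= s then y u else y' (u - s).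
have ltT u : (u%:E < T' + s%:E)%E = ((u - s)%:E < T')%E.
  by rewrite EFinB lteBlDr.
have YyE u : u <= s -> Y u = y u by rewrite /Y => ->.
have Yy'E (u : R) : s - r <= u -> Y u = y' (u - s).
  move=> ru; rewrite /Y; have [us|//] := leP u s.
  have usr : - r <= u - s <= 0 by apply/andP; split; lra.
  case: y'sol => _ /(_ _ usr) -> _ _.
  by rewrite (dde_segmentE ysol) ?ltry// addrC subrK.
case: (ysol) => _ yx /continuous_withinP yc yd.
case: (y'sol) => T'0 y'x /continuous_withinP y'c y'd.
have segYy t : t <= s -> segment r Y t = segment r y t.
  by move=> ts; apply: segment_ext => u /andP[_ u0]; rewrite YyE//; lra.
have segYy' t : s <= t -> segment r Y t = segment r y' (t - s).
  move=> st; apply: segment_ext => u /andP[ru u0]; rewrite Yy'E; last lra.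
  by rewrite addrAC.
split.
- by apply: (lt_le_trans T'0); rewrite leeDl// lee_fin.
- by move=> u /andP[ru u0]; rewrite -/(Y u) YyE ?yx ?ru//; lra.
- apply/continuous_withinP => u [ru uT] e e0; rewrite -/(Y u).
  have [us|su] := ltP u s.
    have [|d d0 yde] := yc u _ e e0; first by split => //; exact: ltry.
    exists (Num.min d (s - u)); first by rewrite lt_min d0 subr_gt0.
    move=> v [rv vT]; rewrite lt_min => /andP[vud vus]; rewrite -/(Y v).
    have vs : v <= s by move: (ler_norm (v - u)); lra.
    rewrite !YyE//; last exact: ltW.
    by apply: yde => //; split => //; exact: ltry.
  have [|d d0 yde] := y'c (u - s) _ e e0; first by split; [lra|rewrite -ltT].
  (* The radius [r] keeps [v] where the glued function is given by [y'], overlap included. *)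
  exists (Num.min d r); first by rewrite lt_min d0.
  move=> v [rv vT]; rewrite lt_min => /andP[vud vur]; rewrite -/(Y v).
  have sv : s - r <= v.
    by move: (ler_norm (u - v)); rewrite distrC; lra.
  rewrite !Yy'E//; last by lra.
  apply: yde; first by split; [lra|rewrite -ltT].
  by have -> : v - s - (u - s) = v - u by ring.
move=> t t0 tT; rewrite -/Y.
have [ts|st|ts] := ltgtP t s.
- rewrite segYy; last exact: ltW.
  apply: (@is_derive_within_comp_shift _ _ _ _ y _ t 0); rewrite ?add0r; last first.
  - exact: yd t t0 (ltry _).
  - by rewrite YyE// ltW.
  exists (s - t); first by rewrite subr_gt0.
  move=> u [u0 uT] ut; rewrite add0r; split; first by split => //; exact: ltry.
  by rewrite YyE//; move: (ler_norm (u - t)); lra.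
- rewrite segYy'; last exact: ltW.
  have ts0 : 0 <= t - s by lra.
  have := y'd (t - s) ts0; rewrite -ltT (_ : s + (t - s) = t); last by ring.
  move=> /(_ tT); rewrite (_ : t - s = - s + t); last by ring.
  apply: (@is_derive_within_comp_shift _ _ _ _ y' Y t (- s)); last first.
    by rewrite Yy'E ?[- s + t]addrC//; lra.
  exists (t - s); first by rewrite subr_gt0.
  move=> u [u0 uT] ut; rewrite addrC.
  have su : s < u by move: (ler_norm (t - u)); rewrite distrC; lra.
  split; first by split; [lra|rewrite -ltT].
  by rewrite Yy'E//; lra.
(* At the junction the left derivative comes from y, the right one from y'. *)
rewrite ts in tT t0 *; rewrite segYy//; apply/is_derive_withinP => e e0.
have /is_derive_withinP/(_ e e0)[d d0 yde] := yd s t0 (ltry _).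
have /is_derive_withinP/(_ e e0)[d' d'0 y'de] := y'd 0 (lexx _) T'0.
have seg0 : segment r y' 0 = segment r y s by apply: segment_init.
rewrite addr0 seg0 in y'de.
exists (Num.min d d'); first by rewrite lt_min d0.
move=> u [u0 uT]; rewrite lt_min => /andP[ud ud'].
have [us|su] := leP u s.
  by rewrite !YyE//; apply: yde => //; split => //; exact: ltry.
rewrite !Yy'E//; [|lra|lra]; rewrite subrr.
have := y'de (u - s); rewrite subr0; apply => //.
by split; [lra|rewrite -ltT].
Qed.

(** A competitor for the shifted problem, concatenated with [y] at time [s], competes with [y];
    maximality of [y] identifies the two. *)
Lemma dde_maximal_shift G x y s : 0 < r -> 0 <= s -> dde_maximal G x +oo%E y ->
  dde_maximal (fun t => G (s + t)) (segment r y s) +oo%E (fun t => y (s + t)).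
Proof.
move=> r0 s0 [ysol ymax]; split; first exact: (dde_solution_shift s0 ysol).
move=> T' y' y'sol; split=> [|t rt tT']; first exact: leey.
have [_ /(_ (s + t))] := ymax _ _ (dde_solution_concat r0 s0 ysol y'sol).
rewrite EFinD [(s%:E + _)%E]addeC lteD2rE// => /(_ _ tT').
have -> : - r <= s + t by lra.
move=> /(_ isT) <-; case: ifPn => [st|_]; last by rewrite addrAC subrr add0r.
have tr : - r <= t <= 0 by apply/andP; split; lra.
by case: y'sol => _ -> // _ _; rewrite (dde_segmentE ysol) ?ltry.
Qed.

Lemma dde_maximal_eq G G' x T y : (forall t, 0 <= t -> G t = G' t) ->
  dde_maximal G x T y -> dde_maximal G' x T y.
Proof.
move=> GG' [[T0 yx yc yd] ymax]; split.
  by split => // t t0 tT; rewrite -GG'//; exact: yd.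
move=> T' y' [T'0 y'x y'c y'd]; apply: ymax; split => // t t0 tT.
by rewrite GG'//; exact: y'd.
Qed.

Lemma dde_maximal_unique G x y y' t : dde_maximal G x +oo%E y ->
  dde_maximal G x +oo%E y' -> - r <= t -> y' t = y t.
Proof. by move=> [_ ymax] [/ymax[_ yy'] _] rt; apply: yy' => //; exact: ltry. Qed.

Lemma dde_lipschitz G x y (T M : R) : 0 <= T -> dde_solution G x +oo%E y ->
  (forall t, 0 <= t <= T -> `|G t (segment r y t)| <= M) ->
  M.-lipschitz_(`[0, T]) y.
Proof.
move=> T0 [_ _ _ yd] GM.
have yM u v : 0 <= u -> u <= v -> v <= T -> `|y v - y u| <= M * (v - u).
  move=> u0 uv vT; apply: (derive_within_ler_dist uv) => s /andP[us sv].
  have s0 := le_trans u0 us; split; last 2 first.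
  - exact: yd s s0 (ltry _).
  - by apply: GM; rewrite s0 (le_trans sv).
  - by split => //; exact: ltry.
move=> [u v] [/=]; rewrite !in_itv/= => /andP[u0 uT] /andP[v0 vT].
have [uv|vu] := leP u v.
  by rewrite distrC [`|u - v|]distrC ger0_norm ?subr_ge0// yM.
by rewrite [`|u - v|]ger0_norm ?yM// ?subr_ge0; exact: ltW.
Qed.

End dde.

(** * Exponential growth rates *)

Lemma eqNy_real_bounds (R : realType) (a : \bar R) :
  (forall c : R, (a <= c%:E)%E) -> a = -oo%E.
Proof.
case: a => [a| |]// H; last by have := H 0.
by have := H (a - 1); rewrite lee_fin leNgt gtrBl ltr01.
Qed.

Section growth_rate.
Context {R : realType}.
Implicit Types (f g : R -> \bar R) (c t : R).

(** The exponential rate of a single trajectory, over which [upper_lyapunov] takes its supremum. *)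
Definition growth_rate f : \bar R :=
  limf_esup (fun t => (t^-1)%:E * lne (f t))%E (pinfty_nbhs R).

(** Turns bounds on rates into exponential bounds; the values 0 and +oo, with logarithms -oo and
    +oo, are covered because [t] is positive. *)
Lemma lne_rate_leE (x : \bar R) c t : 0 < t -> (0 <= x)%E ->
  ((t^-1)%:E * lne x <= c%:E)%E = (x <= (expR (c * t))%:E)%E.
Proof.
move=> t0; case: x => [x| |]// x0; last first.
  by rewrite /= gt0_muley ?lte_fin ?invr_gt0//.
rewrite lee_fin in x0; move: x0; rewrite le_eqVlt => /predU1P[<-|x0].
  by rewrite /= lexx gt0_muleNy ?lte_fin ?invr_gt0// leNye lee_fin expR_ge0.
rewrite lne_EFin// -EFinM !lee_fin mulrC ler_pdivrMr//.
by rewrite -ler_expR lnK ?posrE.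
Qed.

Lemma limf_esup_le (f : R -> \bar R) (F : set_system R) (V : set R) b :
  F V -> (forall t, V t -> (f t <= b)%E) -> (limf_esup f F <= b)%E.
Proof.
move=> FV fb; apply: (@le_trans _ _ (ereal_sup (f @` V))).
  by apply: ereal_inf_lbound; exists V.
by apply: ge_ereal_sup => _ [t Vt <-]; exact: fb.
Qed.

(** If [g] is eventually at most exp(ct), then [f] is eventually at most k exp(ct + |c| r), and
    every rate above [c] absorbs the constant factor. *)
Lemma le_growth_rate_window f g (k r : R) : 0 <= r -> 0 <= k ->
  (forall t, (0 <= f t)%E) -> (forall t, (0 <= g t)%E) ->
  (forall t (M : R), r <= t ->
    (forall s, - r <= s <= 0 -> (g (t + s)%R <= M%:E)%E) ->
    (f t <= (k * M)%:E)%E) ->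
  (growth_rate f <= growth_rate g)%E.
Proof.
move=> r0 k0 f0 g0 fg; rewrite [leRHS]limf_esupE; apply/ereal_infP => _ [V Voo <-].
set b := ereal_sup _.
(* For finite [b], let [c'] decrease to [b]; for [b = -oo], every real number then bounds the rate
   of [f]. *)
suff H c c' : (b <= c%:E)%E -> c < c' -> (growth_rate f <= c'%:E)%E.
  case bE : b => [b'| |].
  - apply/lee_addgt0Pr => e e0; rewrite -EFinD; apply: (H b'); last by rewrite ltrDl.
    by rewrite bE.
  - exact: leey.
  - rewrite leeNy_eq; apply/eqP/eqNy_real_bounds => c.
    by apply: (H (c - 1)); [rewrite bE leNye|rewrite gtrBl].
move=> bc cc'.
apply: (limf_esup_le (V := [set t | ((t^-1)%:E * lne (f t) <= c'%:E)%E])) => //.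
have c'c : 0 < c' - c by rewrite subr_gt0.
case: Voo => T [_ VT].
near=> t.
have t0 : 0 < t by near: t; apply: nbhs_pinfty_gt; rewrite num_real.
rewrite /= lne_rate_leE//.
have tr : r <= t by near: t; apply: nbhs_pinfty_ge; rewrite num_real.
apply: (@le_trans _ _ (k * expR (c * t + `|c| * r))%:E).
  apply: fg => // s /andP[rs s0].
  have ts0 : 0 < t + s.
    have : r < t by near: t; apply: nbhs_pinfty_gt; rewrite num_real.
    lra.
  apply: (@le_trans _ _ (expR (c * (t + s)))%:E).
    rewrite -lne_rate_leE//; apply: le_trans bc; apply: ereal_sup_ubound.
    exists (t + s) => //; apply: VT.
    have : T + r < t by near: t; apply: nbhs_pinfty_gt; rewrite num_real.
    lra.
  (* On the window [c * s] is at most |c| r, whatever the sign of [c]. *)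
  rewrite lee_fin ler_expR mulrDr lerD2l (le_trans (ler_norm _))// normrM.
  by rewrite ler_wpM2l// ler_norml; apply/andP; split; lra.
(* Since [k] may be 0, it is [k + 1] that is written as an exponential. *)
rewrite lee_fin; apply: (@le_trans _ _ ((k + 1) * expR (c * t + `|c| * r))).
  by rewrite ler_wpM2r ?expR_ge0// lerDl.
have k1 : 0 < k + 1 by rewrite ltr_wpDl.
rewrite -[k + 1]lnK ?posrE// -expRD ler_expR.
(* From this time on, the gain [(c' - c) * t] outweighs the factor and the window. *)
suff : (ln (k + 1) + `|c| * r) / (c' - c) <= t.
  rewrite ler_pdivrMr//; lra.
by near: t; apply: nbhs_pinfty_ge; rewrite num_real.
Unshelve. all: by end_near. Qed.

Lemma growth_rate_eventually0 f (r : R) :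
  (forall t, r <= t -> f t = 0%E) -> growth_rate f = -oo%E.
Proof.
move=> f0; apply/eqP; rewrite -leeNy_eq.
apply: (limf_esup_le (V := [set t | Num.max r 0 < t])) => [|t /=].
  by exists (Num.max r 0); split => //; rewrite num_real.
rewrite gt_max => /andP[rt t0]; rewrite f0; last exact: ltW.
by rewrite le0_lneNy// gt0_muleNy// lte_fin invr_gt0.
Qed.

End growth_rate.

(** * Norms and compactness *)

Section norms.
Context {R : realType} {r : R} {E : normedModType R}.
Implicit Types (x : segW r E).

Lemma normE_le_normW x : (normE (x : segC r E) <= normW x)%E.
Proof. by rewrite le_max lexx. Qed.

Lemma normW_ge0 x : (0 <= normW x)%E.
Proof. by rewrite (le_trans _ (normE_le_normW x))// lee_fin. Qed.

Lemma normW_le x (M : R) : 0 < r -> 0 <= M -> `|x : segC r E| <= M ->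
  (forall s, - r <= s <= 0 ->
     exists2 l, is_derive_within `[- r, 0] x s l & `|l| <= M) ->
  (normW x <= M%:E)%E.
Proof.
move=> r0 M0 xM dxM; rewrite ge_max lee_fin xM/=.
apply/ess_supP; apply: aeW => s /=; rewrite lee_fin /patch.
case: ifPn => [/set_mem/=|_]//; rewrite in_itv/= => sr.
have [l xl lM] := dxM s sr.
by rewrite (derive_within_val _ sr xl)// ltrNl oppr0.
Qed.

Lemma normW0 : 0 < r -> normW (0 : segW r E) = 0%E.
Proof.
move=> r0; apply/eqP; rewrite eq_le normW_ge0 andbT normW_le ?normr0// => s _.
exists 0; last by rewrite normr0.
by apply/is_derive_withinP => e e0; exists 1 => // u _ _;
  rewrite scaler0 !subrr normr0 mulr_ge0// ltW.
Qed.

(** Where the derivative exists, [derive_within] commutes with scaling; elsewhere its value is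
    arbitrary, whence the differentiability assumed at every point. *)
Lemma normW_scale_le x (a c : R) : 0 < r ->
  (forall s, - r <= s <= 0 -> exists l, is_derive_within `[- r, 0] x s l) ->
  (normW x <= c%:E)%E -> (normW (a *: x) <= (`|a| * c)%:E)%E.
Proof.
move=> r0 dx; rewrite ge_max lee_fin => /andP[xc /ess_supP dxc].
rewrite ge_max lee_fin; apply/andP; split.
  have -> : (a *: x : segW r E) = a *: (x : segC r E) :> segC r E by [].
  by rewrite normrZ ler_wpM2l.
apply/ess_supP; apply: filterS dxc => s /=; rewrite !lee_fin /patch.
case: ifPn => [/set_mem/=|_] c0; last by rewrite mulr_ge0.
move: c0; rewrite in_itv/= => sr; have [l xl] := dx s sr.
have rr : - r < 0 by rewrite ltrNl oppr0.
rewrite (derive_within_val rr sr xl) => lc.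
rewrite (derive_within_val rr sr (is_derive_within_scale (a := a) xl)).
by rewrite normrZ ler_wpM2l.
Qed.

(** The [normW]-ball about [x] is a subbasic open set that contains [x], and [normW] dominates the
    supremum norm. *)
Lemma continuous_segW_val : 0 < r -> continuous (@segW_val R r E).
Proof.
move=> r0 x; apply/(@cvgrPdist_lt _ _ _ (nbhs (x : segW r E))) => e e0.
rewrite nearE nbhsE/=; exists [set y : segW r E | (normW (y - x)%R < e%:E)%E].
  split; last by rewrite /= subrr normW0// lte_fin.
  exists [set [set y : segW r E | (normW (y - x)%R < e%:E)%E]]; last first.
    by rewrite bigcup_set1.
  by move=> _ ->; apply: (@finI_from1 _ _ _ _ (x, e)).
move=> y /=; rewrite -lte_fin; apply: le_lt_trans.
by rewrite distrC; apply: le_trans (normE_le_normW (y - x)).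
Qed.

End norms.

(** * Operator norms and uniform bounds over compact sets *)

Section operator_norm.
Context {R : realType}.

Lemma opnorm_ge (V U : Type) (NV : V -> \bar R) (NU : U -> \bar R) f v :
  (NV v <= 1)%E -> (NU (f v) <= opnorm NV NU f)%E.
Proof. by move=> v1; apply: ereal_sup_ubound; exists v. Qed.

Lemma opnorm_le (V U : Type) (NV : V -> \bar R) (NU : U -> \bar R) f M :
  (forall v, (NV v <= 1)%E -> (NU (f v) <= M)%E) -> (opnorm NV NU f <= M)%E.
Proof. by move=> fM; apply: ge_ereal_sup => _ [v /fM + <-]. Qed.

Lemma opnorm_ge0 (V : zmodType) (U : Type) (NV : V -> \bar R) (NU : U -> \bar R) f :
  NV 0 = 0%E -> (forall u, (0 <= NU u)%E) -> (0 <= opnorm NV NU f)%E.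
Proof.
by move=> NV0 NU0; apply: le_trans (opnorm_ge _ _ (v := 0) _); rewrite ?NV0.
Qed.

(** Homogeneity lets [v] be normalised into the unit ball over which [opnorm] is a supremum. *)
Lemma ler_opnorm (V U : normedModType R) (f : V -> U) (M : R) v :
  (forall a u, f (a *: u) = a *: f u) ->
  (opnorm normE normE f <= M%:E)%E -> `|f v| <= M * `|v|.
Proof.
move=> fZ fM; have [->|v0] := eqVneq v 0.
  by rewrite -(scale0r (0 : V)) fZ !scale0r !normr0 mulr0.
have v_gt0 : 0 < `|v| by rewrite normr_gt0.
rewrite -ler_pdivrMr//.
have -> : `|f v| / `|v| = `|f (`|v|^-1 *: v)|.
  by rewrite fZ normrZ normfV normr_id mulrC.
rewrite -lee_fin; apply: le_trans fM; apply: (opnorm_ge normE).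
by rewrite /normE normrZ normfV normr_id mulVf ?gt_eqF.
Qed.

(** Near-covering compactness along the filter at +oo: [P q M] holds for [q] near each point and [M]
    large, hence on all of [K] for [M] large. *)
Lemma compact_locally_bounded (T : topologicalType) (K : set T)
    (P : T -> R -> Prop) : compact K ->
  (forall p M N, M <= N -> P p M -> P p N) ->
  (forall p, K p -> exists M, \forall q \near p, P q M) ->
  exists2 M, 0 <= M & forall q, K q -> P q M.
Proof.
move=> /compact_near_coveringP Kc Pmono Pnear.
have [p Kp|M [_ KM]] := Kc R +oo (fun M q => P q M) _.
  have [M PM] := Pnear p Kp.
  exists ([set q | P q M], [set N | M <= N]); last first.
    by move=> [q N] [/= Pq MN]; exact: Pmono Pq.
  by split => //=; apply: nbhs_pinfty_ge; rewrite num_real.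
exists (Num.max 0 (M + 1)); first by rewrite le_max lexx.
by move=> q Kq; apply: KM => //; rewrite lt_max ltrDl ltr01 orbT.
Qed.

Lemma continuous_Lin_locally_bounded (T : topologicalType)
    (V U : normedModType R) (D : T -> V -> U) (p0 : T) :
  continuous_Lin D -> (forall p a u, D p (a *: u) = a *: D p u) ->
  (exists M : R, forall v, `|D p0 v| <= M * `|v|) ->
  exists M : R, \forall p \near p0, forall v, `|D p v| <= M * `|v|.
Proof.
move=> Dc DZ [M DM]; exists (1 + M).
have : nbhs (0 : \bar R) [set x | (x < 1)%E].
  by apply: open_nbhs_nbhs; split; [exact: open_ereal_lt_ereal|rewrite /= lte_fin].
move/(Dc p0) => D1; have {}D1 : \forall p \near p0,
    (opnorm normE normE (D p \- D p0)%R < 1)%E by exact: D1.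
apply: filterS D1 => p /= /ltW Dp v.
rewrite -[D p v](subrK (D p0 v)) (le_trans (ler_normD _ _))// mulrDl lerD//.
apply: (@ler_opnorm _ _ (D p \- D p0)) => // a u /=.
by rewrite !DZ scalerBr.
Qed.

Lemma diff_scale (V U : normedModType R) (f : V -> U) (x : V) a u :
  'd f x (a *: u) = a *: 'd f x u.
Proof. by rewrite linearZ. Qed.

Lemma diff_bounded (V U : normedModType R) (f : V -> U) (x : V) :
  differentiable f x -> exists M : R, forall v, `|'d f x v| <= M * `|v|.
Proof.
move=> /diff_continuous/linear_bounded_continuous/linear_boundedP[M [_ MP]].
by exists (M + 1); apply: MP; rewrite ltrDl.
Qed.

Lemma continuous_Lin_compact_bounded (T S : topologicalType)
    (V U : normedModType R) (D : T -> V -> U) (g : S -> T) (A : set S) :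
  compact A -> continuous g -> continuous_Lin D ->
  (forall p a u, D p (a *: u) = a *: D p u) ->
  (forall p, exists M : R, forall v, `|D p v| <= M * `|v|) ->
  exists2 M : R, 0 <= M & forall q, A q -> forall v, `|D (g q) v| <= M * `|v|.
Proof.
move=> Ac gc Dc DZ DM.
apply: (@compact_locally_bounded _ A
  (fun q M => forall v, `|D (g q) v| <= M * `|v|)) => // [p M N MN DN v|p _].
  by rewrite (le_trans (DN v))// ler_wpM2r.
have [M DgM] := continuous_Lin_locally_bounded Dc DZ (DM (g p)).
by exists M; exact: (gc p _ DgM).
Qed.

End operator_norm.

(** * The semiflow and its linearization *)

Lemma continuous_pair (T U V : topologicalType) (f : T -> U) (g : T -> V) :
  continuous f -> continuous g -> continuous (fun x => (f x, g x)).
Proof. by move=> fc gc x; apply: (cvg_pair (fc x) (gc x)). Qed.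

Section evaluation.
Context {R : realType} {r : R} {E : normedModType R}.

(** The difference is split at [h p (d q)]: continuity of the fixed segment [h p] handles the moving
    time, the supremum norm the moving segment. *)
Lemma continuous_segC_eval (T : topologicalType) (h : T -> segC r E) (d : T -> R) :
  continuous h -> continuous d -> (forall p, - r <= d p <= 0) ->
  continuous (fun p => h p (d p)).
Proof.
move=> hc dc dr p; apply/cvgrPdist_le => e e0.
have dP q : `[- r, 0]%classic (d q) by rewrite /= in_itv/=.
have /continuous_withinP/(_ _ (dP p) (e / 2))[|dl dl0 hp] := segC_within (x := h p).
  by rewrite divr_gt0.
have : \forall q \near p, `|h p - h q| <= e / 2.
  by move/cvgrPdist_le: (hc p); apply; rewrite divr_gt0.
have : \forall q \near p, `|d p - d q| < dl by move/cvgrPdist_lt: (dc p); apply.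
apply: filterS2 => q dq hq.
rewrite -[_ - _](subrKA (h p (d q))) (splitr e) (le_trans (ler_normD _ _))// lerD//.
  by rewrite distrC; apply: hp => //; rewrite distrC.
exact: le_trans (segC_norm_ge (h p - h q) (d q)) hq.
Qed.

Lemma continuous_compact_bounded (T : topologicalType) (f : T -> E) (A : set T) :
  compact A -> {within A, continuous f} ->
  exists2 M, 0 <= M & forall q, A q -> `|f q| <= M.
Proof.
move=> Ac fc; have := continuous_compact fc Ac.
move=> /compact_bounded[M [_ fM]]; exists (Num.max 0 (M + 1)).
  by rewrite le_max lexx.
move=> q Aq; apply: fM; last by exists q.
by rewrite lt_max ltrDl ltr01 orbT.
Qed.

Lemma dde_bounded G (x : segC r E) y (T : R) : 0 < r -> 0 <= T ->
  dde_solution G x +oo%E y ->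
  exists2 m, 0 <= m & forall t, 0 <= t <= T -> `|segment r y t| <= m.
Proof.
move=> r0 T0 ysol; case: (ysol) => _ _ yc _.
have [||M M0 yM] := @continuous_compact_bounded _ y `[- r, T].
- exact: segment_compact.
- apply: continuous_subspaceW yc => u /=; rewrite in_itv/= => /andP[ru _].
  by split => //; exact: ltry.
exists M => // t /andP[t0 tT]; apply: segC_norm_le => // s /=.
rewrite in_itv/= => sr; rewrite (dde_segmentE ysol) ?ltry//.
by case/andP: sr => rs s0; apply: yM; rewrite /= in_itv/=; apply/andP; split; lra.
Qed.

End evaluation.

(** * The nonlinear semiflow on K *)

Section nonlinear_semiflow.
Context {R : realType} {r : R} {E : normedModType R} {Omega : metricType R}.
Variables (sigma : R -> Omega -> Omega) (F : Omega -> E -> E -> E)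
  (tau : Omega -> segC r E -> R) (K : set (Omega * segW r E)).
Hypotheses (r_gt0 : 0 < r) (Omega_compact : compact [set: Omega])
  (sigma_flow : is_flow sigma) (tau_range : forall w x, 0 <= tau w x <= r)
  (hF : H1 F) (htau : H2_1 tau) (K_compact : compact K)
  (K_invariant : positively_invariant sigma F tau K)
  (K_backward : forall p, K p -> backward_extension sigma F tau K p).

Local Notation Pi := (Pi sigma F tau).
Local Notation sol := (sol sigma F tau).

(** The default of [xget] has existence time 0, so [beta = +oo] forces a maximal solution to
    exist. *)
Lemma sol_maximal p : K p ->
  dde_maximal (vector_field sigma F tau p.1) p.2 +oo%E (sol p.1 p.2).
Proof.
move=> /K_invariant[+ _]; rewrite /beta /Defs.sol /maximal_solution.
set P := [set Ty | _]; have [[Ty PTy]|nP] := pselect (exists Ty, P Ty).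
  have := @xgetPex _ (0%E, cst 0) P (ex_intro _ _ PTy).
  by move=> /[swap] betaoo; rewrite /P/= betaoo.
by rewrite xgetPN// => Ty PTy; apply: nP; exists Ty.
Qed.

Lemma sol_solution p : K p ->
  dde_solution (vector_field sigma F tau p.1) p.2 +oo%E (sol p.1 p.2).
Proof. by move=> /sol_maximal[]. Qed.

Lemma tau_itv w x : - r <= - tau w x <= 0.
Proof. by rewrite lerN2 oppr_le0 andbC tau_range. Qed.

(** All arguments of [F] stay in the product of [Omega] and two copies of the compact set
    [y([-r, T])]. *)
Lemma vector_field_bounded p (T : R) : K p -> 0 <= T ->
  exists2 M, 0 <= M & forall t, 0 <= t <= T ->
    `|vector_field sigma F tau p.1 t (segment r (sol p.1 p.2) t)| <= M.
Proof.
move=> Kp T0; have ysol := sol_solution Kp; set y := sol _ _ in ysol *.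
case: (ysol) => _ _ yc _; case: hF => Fc _ _ _ _.
have yK : compact (y @` `[- r, T]).
  apply: continuous_compact (@segment_compact _ _ _).
  apply: continuous_subspaceW yc => u /=; rewrite in_itv/= => /andP[ru _].
  by split => //; exact: ltry.
have Kc := compact_setX (compact_setX Omega_compact yK) yK.
have [M M0 FM] := continuous_compact_bounded Kc (continuous_subspaceT Fc).
exists M => // t /andP[t0 tT]; rewrite /vector_field.
have rr : - r <= 0 by rewrite oppr_le0 ltW.
rewrite !(dde_segmentE ysol) ?ltry ?tau_itv ?rr ?lexx// addr0.
apply: (FM (_, _, _)); split => /=; first split => //=.
  by exists t => //; rewrite /= in_itv/= tT (le_trans rr).
set d := tau _ _; exists (t - d) => //=; rewrite in_itv/=.
have : 0 <= d <= r by exact: tau_range.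
have := r_gt0.
by move=> r0 /andP[d0 dr]; apply/andP; split; lra.
Qed.

(** The solution is Lipschitz on [[- r, t]], by its initial segment and then by the bounded vector
    field, so [to_segW] returns the segment itself. *)
Lemma Pi_val p (t : R) : K p -> 0 <= t ->
  (Pi t p).2 = segment r (sol p.1 p.2) t :> segC r E.
Proof.
move=> Kp t0; rewrite /= /to_segW insubdK//.
have ysol := sol_solution Kp; set y := sol _ _ in ysol *.
have [M M0 yM] := vector_field_bounded Kp t0.
have yM' := dde_lipschitz t0 ysol yM.
have [k xk] : exists k : R, k.-lipschitz_(`[- r, 0]) p.2.
  by case: p.2 => x /= /asboolP.
have yk : k.-lipschitz_(`[- r, 0]) y.
  case: ysol => _ yx _ _ [u v] [/= ur vr].
  rewrite !yx; [exact: (xk (u, v))| |]; first by rewrite in_itv/= in vr.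
  by rewrite in_itv/= in ur.
have rr : - r <= 0 by rewrite oppr_le0 ltW.
have := lipschitz_itv_cat rr t0 yk yM'.
apply: segment_lipschitz => //; lra.
Qed.

Lemma Pi_in p (t : R) : K p -> 0 <= t -> K (Pi t p).
Proof. by move=> /K_invariant[_ +] t0; apply. Qed.

(** The translated solution is maximal from [Pi s p], its vector field being that of the translated
    base point by the flow law; uniqueness concludes. *)
Lemma Pi_add p (s t : R) : K p -> 0 <= s -> 0 <= t -> Pi t (Pi s p) = Pi (s + t) p.
Proof.
move=> Kp s0 t0; case: (sigma_flow) => _ _ sigmaD.
rewrite {1 3}/Defs.Pi; congr (_, _); first by rewrite -sigmaD addrC.
congr to_segW; apply: segment_ext => u /andP[ru u0].
have shift := dde_maximal_shift r_gt0 s0 (sol_maximal Kp).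
rewrite -(Pi_val Kp s0) in shift.
have -> : s + t + u = s + (t + u) by ring.
apply: (dde_maximal_unique (x := (Pi s p).2) (y := fun v => sol p.1 p.2 (s + v)) _
  (sol_maximal (Pi_in Kp s0))); last lra.
rewrite (_ : vector_field _ _ _ _ = (fun v => vector_field sigma F tau p.1 (s + v)))//.
by apply/funext => v; apply/funext => phi; rewrite /vector_field/= addrC sigmaD.
Qed.

(** The point at which [vector_field] evaluates [F] and [L] evaluates its partial derivatives. *)
Definition delayed_state (p : Omega * segW r E) : Omega * E * E :=
  (p.1, p.2 0, p.2 (- tau p.1 p.2)).

Lemma continuous_snd_segC :
  continuous (fun p : Omega * segW r E => p.2 : segC r E).
Proof.
move=> p; apply: (@continuous_comp _ _ _ snd (@segW_val R r E)).
  exact: cvg_snd.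
exact: continuous_segW_val.
Qed.

Lemma continuous_delayed_state : continuous delayed_state.
Proof.
have valc := continuous_snd_segC.
have tauc : continuous (fun p : Omega * segW r E => - tau p.1 p.2).
  move=> p; apply: continuousN; case: htau => tauc _ _.
  apply: (@continuous_comp _ _ _ (fun p : Omega * segW r E => (p.1, p.2 : segC r E))
    (fun p : Omega * segC r E => tau p.1 p.2)); last exact: tauc.
  by apply: continuous_pair => // ?; exact: cvg_fst.
apply: continuous_pair; first apply: continuous_pair.
- by move=> p; exact: cvg_fst.
- apply: (continuous_segC_eval (d := fun=> 0) valc) => [?|_]; first exact: cvg_cst.
  by rewrite lexx oppr_le0 ltW.
- by apply: (continuous_segC_eval valc tauc) => p; exact: tau_itv.
Qed.

(* The backward extension through p exhibits p.2 as the last segment of a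
   solution that has evolved in K for a time r, so its derivative is given by F. *)
Lemma derive_within_bounded : exists2 M : R, 0 <= M &
  forall p s, K p -> - r <= s <= 0 ->
    exists2 l, is_derive_within `[- r, 0] p.2 s l & `|l| <= M.
Proof.
case: hF => Fc _ _ _ _.
have FKc : continuous (fun p => let q := delayed_state p in F q.1.1 q.1.2 q.2).
  move=> p; apply: (@continuous_comp _ _ _ delayed_state
    (fun q : Omega * E * E => F q.1.1 q.1.2 q.2)); last exact: Fc.
  exact: continuous_delayed_state.
have [M M0 FM] := continuous_compact_bounded K_compact (continuous_subspaceT FKc).
exists M => // p s Kp sr; have [theta [_ Kth th0 thP]] := K_backward Kp.
have rr : - r <= 0 by rewrite oppr_le0 ltW.
set q := theta (- r); have Kq : K q by exact: Kth.
have Piq : Pi r q = p by rewrite thP// subrr.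
have rs0 : 0 <= r + s by case/andP: sr => ? _; lra.
have ysol := sol_solution Kq; set y := sol _ _ in ysol.
have px : p.2 = segment r y r :> segC r E by rewrite -Piq Pi_val// ltW.
have pE u : - r <= u <= 0 -> p.2 u = y (r + u).
  by move=> ur; rewrite px (dde_segmentE ysol) ?ltry// ltW.
exists (vector_field sigma F tau q.1 (r + s) (segment r y (r + s))).
  apply: (@is_derive_within_comp_shift _ _ _ _ y _ s r); last 2 first.
  - exact: pE.
  - by case: ysol => _ _ _; apply => //; exact: ltry.
  exists 1 => // u; rewrite /= in_itv/= => ur _; rewrite pE//; split => //.
  by split; [case/andP: ur => ? _; lra|exact: ltry].
(* The vector field at time [r + s] is [F] at the delayed state of [Pi (r + s) q], a point of
   [K]. *)
have := FM _ (Pi_in Kq rs0).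
by rewrite /delayed_state /= -/(Pi (r + s) q) (Pi_val Kq rs0).
Qed.

(** * The linearized equation and its solution operators *)

Local Notation L := (L F tau).
Local Notation z_tilde := (z_tilde sigma F tau).
Local Notation pi_tilde := (pi_tilde sigma F tau).
Local Notation pi_hat := (pi_hat sigma F tau).
Local Notation pi_L := (pi_L sigma F tau).

Lemma L_scale p a phi : L p (a *: phi) = a *: L p phi.
Proof.
case: p => w x; rewrite /Defs.L /D2tau /D2F /D3F.
rewrite -[(a *: phi) 0]/(a *: phi 0) -[(a *: phi) (- _)]/(a *: phi (- _)).
have -> : 'd (tau w) (x : segC r E) (a *: phi) = a * 'd (tau w) (x : segC r E) phi.
  by rewrite linearZ.
by rewrite !linearZ/= -scalerA -!scalerDr.
Qed.

(** The differentials are continuous in operator norm, hence bounded over the compact [K]; the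
    derivative of the segment is bounded thanks to the backward extensions. *)
Lemma L_bounded : exists2 M : R, 0 <= M &
  forall p phi, K p -> `|L p phi| <= M * `|phi|.
Proof.
case: hF => _ dF2 dF3 D2Fc D3Fc; case: htau => _ dtau D2tauc.
have [M2 M20 D2FM] := continuous_Lin_compact_bounded K_compact
  continuous_delayed_state D2Fc (fun p a u => diff_scale _ _ a u)
  (fun p => diff_bounded (dF2 p.1.1 p.1.2 p.2)).
have [M3 M30 D3FM] := continuous_Lin_compact_bounded K_compact
  continuous_delayed_state D3Fc (fun p a u => diff_scale _ _ a u)
  (fun p => diff_bounded (dF3 p.1.1 p.1.2 p.2)).
have valc : continuous (fun p : Omega * segW r E => (p.1, p.2 : segC r E)).
  apply: continuous_pair => [p|]; first exact: cvg_fst.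
  exact: continuous_snd_segC.
have [Mt Mt0 D2tauM] := continuous_Lin_compact_bounded K_compact
  valc D2tauc (fun p a u => diff_scale _ _ a u)
  (fun p => diff_bounded (dtau p.1 p.2)).
have [Mx Mx0 dxM] := derive_within_bounded.
exists (M2 + M3 + Mt * (M3 * Mx)); first by rewrite !addr_ge0// !mulr_ge0.
move=> [w x] phi Kp; rewrite /Defs.L.
have phiE s : `|phi s| <= `|phi| by exact: segC_norm_ge.
rewrite mulrDl (le_trans (ler_normB _ _))// lerD//.
  rewrite mulrDl (le_trans (ler_normD _ _))// lerD//.
    by rewrite (le_trans (D2FM _ Kp _))// ler_wpM2l.
  by rewrite (le_trans (D3FM _ Kp _))// ler_wpM2l.
have [l xl lM] := dxM (w, x) (- tau w x) Kp (tau_itv w x).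
have rr : - r < 0 by rewrite ltrNl oppr0.
rewrite (derive_within_val rr (tau_itv w x) xl) normrZ.
have -> : Mt * (M3 * Mx) * `|phi| = (Mt * `|phi|) * (M3 * Mx) by ring.
rewrite ler_pM//; first exact: (D2tauM _ Kp).
by rewrite (le_trans (D3FM _ Kp _))// ler_wpM2l.
Qed.

Lemma z_tilde_cases p v :
  dde_maximal (fun t => L (Pi t p)) v +oo%E (z_tilde p v) \/
  (forall z, ~ dde_maximal (fun t => L (Pi t p)) v +oo%E z) /\
    z_tilde p v = cst 0.
Proof.
rewrite /Defs.z_tilde; set P := [set z | _].
have [[z Pz]|nP] := pselect (exists z, P z).
  by left; exact: (@xgetPex _ (cst 0) P (ex_intro _ _ Pz)).
have nP' z : ~ P z by move=> Pz; apply: nP; exists z.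
by right; split => //; rewrite xgetPN.
Qed.

Lemma z_tilde_maximal p v z t :
  dde_maximal (fun t => L (Pi t p)) v +oo%E z -> - r <= t ->
  z_tilde p v t = z t.
Proof.
move=> zmax rt; have [/dde_maximal_unique|[/(_ z)//]] := z_tilde_cases p v.
by move=> /(_ _ _ zmax rt) ->.
Qed.

(** The initial value is left open because the default function 0 solves the equation from 0, not
    from [v]. *)
Lemma z_tilde_solution p v : exists v',
  dde_solution (fun t => L (Pi t p)) v' +oo%E (z_tilde p v).
Proof.
have [[zsol _]|[_ ->]] := z_tilde_cases p v; first by exists v.
by exists 0; apply: dde_solution0 => *; exact: L_scale.
Qed.

Lemma pi_tildeE p v (t s : R) : 0 <= t -> - r <= s <= 0 ->
  pi_tilde t p v s = z_tilde p v (t + s).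
Proof.
move=> t0 sr; have [v' zsol] := z_tilde_solution p v.
by rewrite /Defs.pi_tilde (dde_segmentE zsol) ?ltry.
Qed.

(** A maximal solution from 0 extends the zero solution, hence equals it; the default is 0 as
    well. *)
Lemma pi_tilde0 p (t : R) : 0 <= t -> pi_tilde t p 0 = 0.
Proof.
move=> t0; have [[_ zmax]|[_ z0]] := z_tilde_cases p 0; last first.
  by rewrite /Defs.pi_tilde z0 segment_cst0.
have LZ (u c : R) phi : 0 <= u -> L (Pi u p) (c *: phi) = c *: L (Pi u p) phi.
  by move=> _; exact: L_scale.
have [_ z0] := zmax _ _ (dde_solution0 LZ).
apply: segC_ext => s sr; rewrite pi_tildeE// -z0//; last exact: ltry.
by case/andP: sr => ? _; lra.
Qed.

Lemma pi_tilde_scale p v a (t : R) : 0 <= t ->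
  pi_tilde t p (a *: v) = a *: pi_tilde t p v.
Proof.
move=> t0; have [->|a0] := eqVneq a 0; first by rewrite !scale0r pi_tilde0.
have LZ (u c : R) phi : 0 <= u -> L (Pi u p) (c *: phi) = c *: L (Pi u p) phi.
  by move=> _; exact: L_scale.
have [zmax|[nz z0]] := z_tilde_cases p v.
  apply: segC_ext => s sr.
  rewrite -[RHS]/(a *: pi_tilde t p v s) !pi_tildeE//.
  rewrite (z_tilde_maximal (dde_maximal_scale a0 LZ zmax))//.
  by case/andP: sr => ? _; lra.
(* A maximal solution from [a *: v] would scale back to one from [v]; so there is none, and both
   sides are 0. *)
have [|[_ z0']] := z_tilde_cases p (a *: v).
  move=> /(dde_maximal_scale (invr_neq0 a0) LZ).
  by rewrite scalerK// => /nz.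
by rewrite /Defs.pi_tilde z0 z0' segment_cst0 scaler0.
Qed.

(** Cocycle identity: by [Pi_add], the translated solution solves the equation linearized along the
    orbit of [Pi s p]. In the default case everything is 0. *)
Lemma pi_tilde_add p v (s t : R) : K p -> 0 <= s -> 0 <= t ->
  pi_tilde t (Pi s p) (pi_tilde s p v) = pi_tilde (s + t) p v.
Proof.
move=> Kp s0 t0.
have [zmax|[_ z0]] := z_tilde_cases p v; last first.
  by rewrite {2 3}/Defs.pi_tilde z0 !segment_cst0 pi_tilde0.
have LPi (u : R) : 0 <= u -> L (Pi (s + u) p) = L (Pi u (Pi s p)).
  by move=> u0; rewrite Pi_add.
have zmax' := dde_maximal_eq LPi (dde_maximal_shift r_gt0 s0 zmax).
apply: segment_ext => u /andP[ru u0].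
rewrite (z_tilde_maximal zmax'); first by rewrite addrA.
by lra.
Qed.

(** From time [r] on, the whole segment lies over nonnegative times, where the equation holds. *)
Lemma pi_tilde_derive p v (t s : R) : r <= t -> - r <= s <= 0 ->
  is_derive_within `[- r, 0] (pi_tilde t p v) s
    (L (Pi (t + s) p) (pi_tilde (t + s) p v)).
Proof.
move=> rt sr; have [v' [_ _ _ zd]] := z_tilde_solution p v.
have t0 : 0 <= t by rewrite (le_trans _ rt)// ltW.
have ts0 u : - r <= u <= 0 -> 0 <= t + u by move=> /andP[? _]; lra.
apply: (@is_derive_within_comp_shift _ _ _ _ (z_tilde p v) _ s t); last 2 first.
- by rewrite pi_tildeE.
- by apply: zd; [exact: ts0|exact: ltry].
exists 1 => // u; rewrite /= in_itv/= => ur _; rewrite pi_tildeE//.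
by split => //; split; [exact: ts0|exact: ltry].
Qed.

Lemma pi_tilde_bounded p v (T : R) : 0 <= T ->
  exists2 m, 0 <= m & forall t, 0 <= t <= T -> `|pi_tilde t p v| <= m.
Proof.
by move=> T0; have [v' zsol] := z_tilde_solution p v; exact: dde_bounded zsol.
Qed.

(** Smoothing: on [[0, t]] the derivative is bounded through [L_bounded], so the segment is
    Lipschitz even if [v] is only continuous. *)
Lemma pi_hat_val p v (t : R) : K p -> r <= t ->
  pi_hat t p v = pi_tilde t p v :> segC r E.
Proof.
move=> Kp rt; rewrite /Defs.pi_hat /to_segW insubdK//.
have [v' zsol] := z_tilde_solution p v.
have t0 : 0 <= t by rewrite (le_trans _ rt)// ltW.
have [m m0 zm] := pi_tilde_bounded p v t0.
have [M M0 LM] := L_bounded.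
have zM : forall u, 0 <= u <= t -> `|L (Pi u p) (pi_tilde u p v)| <= M * m.
  move=> u ut; case/andP: (ut) => u0 _.
  by rewrite (le_trans (LM _ _ (Pi_in Kp u0)))// ler_wpM2l// zm.
have := dde_lipschitz t0 zsol zM.
by apply: segment_lipschitz => //; lra.
Qed.

(** The values are at most [m] and the derivatives at most [M * m]. This estimate underlies (i) and
    (ii), and finiteness of the norm in (iii). *)
Lemma normW_pi_hat_le p v (t M m : R) : K p -> r <= t -> 0 <= M -> 0 <= m ->
  (forall q phi, K q -> `|L q phi| <= M * `|phi|) ->
  (forall s, - r <= s <= 0 -> `|pi_tilde (t + s) p v| <= m) ->
  (normW (pi_hat t p v) <= ((1 + M) * m)%:E)%E.
Proof.
move=> Kp rt M0 m0 LM zm.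
have rr : - r <= 0 by rewrite oppr_le0 ltW.
apply: normW_le => //; first by rewrite mulr_ge0// addr_ge0.
  rewrite pi_hat_val// mulrDl mul1r; apply: (@le_trans _ _ m).
    by have := zm 0; rewrite addr0 rr lexx; apply.
  by rewrite lerDl mulr_ge0.
move=> s sr; exists (L (Pi (t + s) p) (pi_tilde (t + s) p v)).
  by rewrite pi_hat_val//; exact: pi_tilde_derive.
have ts0 : 0 <= t + s by case/andP: sr => ? _; lra.
rewrite (le_trans (LM _ _ (Pi_in Kp ts0)))// (@le_trans _ _ (M * m))//.
  by rewrite ler_wpM2l// zm.
by rewrite mulrDl mul1r lerDr.
Qed.

Lemma normE_pi_tilde_le p v (t : R) : K p -> r <= t ->
  (normE (pi_tilde t p v) <= normW (pi_L (t - r) (Pi r p) (pi_hat r p v)))%E.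
Proof.
move=> Kp rt; apply: le_trans (normE_le_normW _).
rewrite /Defs.pi_L pi_hat_val//.
have tr0 : 0 <= t - r by rewrite subr_ge0.
have r0 := ltW r_gt0.
rewrite pi_tilde_add// (_ : r + (t - r) = t); last by ring.
(* The time [t - r] may be below [r]; the Lipschitz property comes from the total time [t] elapsed
   since [p]. *)
by rewrite -/(pi_hat t p v) pi_hat_val.
Qed.

(** * Comparison of the operator norms and of the Lyapunov exponents *)

Lemma C0E : K !=set0 -> exists2 M : R, 0 <= M & C0 F tau K = M%:E /\
  forall p phi, K p -> `|L p phi| <= M * `|phi|.
Proof.
move=> [p0 Kp0]; have [M M0 LM] := L_bounded.
have C0M : (C0 F tau K <= M%:E)%E.
  apply: ge_ereal_sup => _ [p Kp <-]; apply: opnorm_le => v; rewrite !lee_fin => v1.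
  by rewrite (le_trans (LM _ _ Kp))// ler_piMr.
have LC0 p : K p -> (opnorm normE normE (L p) <= C0 F tau K)%E.
  by move=> Kp; apply: ereal_sup_ubound; exists p.
(* A point of [K] keeps the supremum away from -oo. *)
have C00 : (0 <= C0 F tau K)%E.
  apply: le_trans (LC0 _ Kp0); apply: opnorm_ge0 => [|u]; last by rewrite lee_fin.
  by rewrite /normE normr0.
have C0fin : C0 F tau K \is a fin_num.
  by rewrite ge0_fin_numE// (le_lt_trans C0M)// ltry.
exists (fine (C0 F tau K)); first exact: fine_ge0.
split=> [|p phi Kp]; first by rewrite fineK.
by apply: ler_opnorm => [a u|]; [exact: L_scale|rewrite fineK//; exact: LC0].
Qed.

Lemma opnorm_pi_L_le p (t : R) : r <= t -> K p ->
  (opnorm normW normW (pi_L t p) <= (1 + C0 F tau K) *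
    ereal_sup [set opnorm normE normE (pi_tilde (t + s)%R p)
              | s in `[(- r)%R, 0%R]])%E.
Proof.
move=> rt Kp; have [M M0 [-> LM]] := C0E (ex_intro _ _ Kp).
set S := ereal_sup _.
have SP (s : R) : - r <= s <= 0 -> (opnorm normE normE (pi_tilde (t + s)%R p) <= S)%E.
  by move=> sr; apply: ereal_sup_ubound; exists s => //; rewrite /= in_itv.
have rr : - r <= 0 by rewrite oppr_le0 ltW.
have S0 : (0 <= S)%E.
  apply: le_trans (SP 0 _); last by rewrite rr lexx.
  apply: opnorm_ge0 => [|u]; last by rewrite lee_fin.
  by rewrite /normE normr0.
have M1 : 0 < 1 + M by rewrite ltr_pwDl.
(* An infinite supremum makes the right-hand side +oo because [1 + M] is positive. *)
case SE : S => [m| |]; last 2 first.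
- by rewrite -EFinD gt0_muley ?leey// lte_fin.
- by move: S0; rewrite SE.
apply: opnorm_le => v v1; rewrite -EFinD -EFinM.
have m0 : 0 <= m by rewrite -lee_fin -SE.
(* [pi_L t p v] is convertible to [pi_hat t p] at the underlying continuous segment, which lies in
   the unit ball of C. *)
apply: normW_pi_hat_le => // s sr; rewrite -lee_fin -SE.
apply: le_trans (SP _ sr); apply: (opnorm_ge normE).
exact: le_trans (normE_le_normW v) v1.
Qed.

(** A nonzero Lipschitz [v] is also a competitor in C, and the window comparison applies with factor
    1 + C0. *)
Lemma lambda_s_le p : K p ->
  (lambda_s sigma F tau p <= lambda_tilde_s sigma F tau p)%E.
Proof.
move=> Kp; apply: ge_ereal_sup => _ [v /= v0 <-].
have v0' : (v : segC r E) != 0.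
  by apply: contra_neq v0 => v0; exact: val_inj.
apply: (@le_trans _ _ (growth_rate (fun t => normE (pi_tilde t p v)))); last first.
  by apply: ereal_sup_ubound; exists (v : segC r E).
have [M M0 [_ LM]] := C0E (ex_intro _ _ Kp).
have rr : - r <= 0 by rewrite oppr_le0 ltW.
apply: (@le_growth_rate_window _ _ _ (1 + M) r); first exact: ltW.
- by rewrite addr_ge0.
- by move=> t; exact: normW_ge0.
- by move=> t; rewrite lee_fin.
move=> t m rt zm; apply: normW_pi_hat_le => //.
have := zm 0; rewrite rr lexx lee_fin => /(_ isT).
exact: le_trans.
Qed.

Lemma opnorm_pi_tilde_le p (t : R) : r <= t -> K p ->
  (opnorm normE normE (pi_tilde t p) <= hatC sigma F tau K *
    opnorm normW normW (pi_L (t - r)%R (Pi r p)))%E.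
Proof.
move=> rt Kp; set A := opnorm normW normW _.
have A0 : (0 <= A)%E by apply: opnorm_ge0 => [|u]; [exact: normW0|exact: normW_ge0].
apply: opnorm_le => v v1.
have t0 : 0 <= t by rewrite (le_trans _ rt)// ltW.
have r0 := ltW r_gt0.
have wC : (normW (pi_hat r p v) <= hatC sigma F tau K)%E.
  apply: (@le_trans _ _ (opnorm normE normW (pi_hat r p))); first exact: opnorm_ge.
  by apply: ereal_sup_ubound; exists p.
(* It remains to bound the left-hand side by the W-norm of [pi_hat r p v] times [A]. *)
apply: le_trans (lee_wpmul2r A0 wC).
have [M M0 LM] := L_bounded.
have [m m0 zm] := pi_tilde_bounded p v r0.
have wfin : normW (pi_hat r p v) \is a fin_num.
  rewrite ge0_fin_numE ?normW_ge0//; apply: le_lt_trans (ltry ((1 + M) * m)).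
  apply: normW_pi_hat_le => // s /andP[rs s0]; apply: zm.
  by apply/andP; split; lra.
set c := fine (normW (pi_hat r p v)).
have cE : normW (pi_hat r p v) = c%:E by rewrite fineK.
have c0 : 0 <= c by rewrite fine_ge0 ?normW_ge0.
(* If that norm is 0, the trajectory vanishes at time [r] and, by the cocycle identity, at time
   [t]. *)
rewrite cE; move: c0; rewrite le_eqVlt => /predU1P[c0|c0].
  suff -> : pi_tilde t p v = 0 by rewrite /normE normr0 -c0 mul0e.
  have w0 : pi_tilde r p v = 0.
    apply/eqP; rewrite -normr_le0 -lee_fin c0 -cE -(pi_hat_val _ Kp (lexx r)).
    exact: normE_le_normW.
  have tr0 : 0 <= t - r by rewrite subr_ge0.
  have -> : t = r + (t - r) by ring.
  by rewrite -pi_tilde_add// w0 pi_tilde0.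
have cn0 : c != 0 by rewrite gt_eqF.
(* Rescaled so that the image at time [r] lies in the unit ball of W. *)
pose v' := c^-1 *: v.
have -> : v = c *: v' by rewrite scalerKV.
rewrite pi_tilde_scale// /normE normrZ gtr0_norm// EFinM.
apply: lee_wpmul2l; first by rewrite lee_fin ltW.
apply: le_trans (normE_pi_tilde_le v' Kp rt) _.
apply: opnorm_ge.
have -> : pi_hat r p v' = c^-1 *: pi_hat r p v.
  apply/val_inj => /=; rewrite (pi_hat_val _ Kp (lexx r)).
  rewrite -[RHS]/(c^-1 *: (pi_hat r p v : segC r E)) (pi_hat_val _ Kp (lexx r)).
  exact: pi_tilde_scale.
have -> : 1%E = (`|c^-1| * c)%:E by rewrite gtr0_norm ?invr_gt0// mulVf.
apply: normW_scale_le => //; last by rewrite cE.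
(* At time [r] the segment is differentiable at every point, as the scaling of [normW] requires. *)
move=> s sr; exists (L (Pi (r + s) p) (pi_tilde (r + s) p v)).
by rewrite pi_hat_val//; exact: pi_tilde_derive.
Qed.

Lemma lambda_tilde_s_le p : K p ->
  (lambda_tilde_s sigma F tau p <= lambda_s sigma F tau (Pi r p))%E.
Proof.
move=> Kp; apply: ge_ereal_sup => _ [v /= v0 <-].
have r0 := ltW r_gt0.
have rr : - r <= 0 by rewrite oppr_le0.
(* A vanishing [w] is no competitor in [lambda_s]; the trajectory of [v] is then 0 from time [r] on,
   with rate -oo. *)
set w := pi_hat r p v; have [w0|w0] := eqVneq w 0.
  suff : growth_rate (fun t => normE (pi_tilde t p v)) = -oo%E.
    by rewrite /growth_rate => ->; exact: leNye.
  apply: (@growth_rate_eventually0 _ _ r) => t rt.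
  apply: le_anti; apply/andP; split; last by rewrite lee_fin.
  rewrite (le_trans (normE_pi_tilde_le v Kp rt))// -/w w0.
  have -> : pi_L (t - r) (Pi r p) 0 = 0.
    apply/val_inj => /=; rewrite /Defs.pi_L pi_tilde0 ?subr_ge0//.
    by rewrite /to_segW insubdK//; exact: valP (0 : segW r E).
  by rewrite normW0.
apply: (@le_trans _ _ (growth_rate (fun t => normW (pi_L t (Pi r p) w)))); last first.
  by apply: ereal_sup_ubound; exists w.
apply: (@le_growth_rate_window _ (fun t => normE (pi_tilde t p v)) _ 1 r) => //.
- by move=> t; rewrite lee_fin.
- by move=> t; exact: normW_ge0.
move=> t m rt wm; rewrite mul1r.
(* Only the endpoint [s = - r] of the window is used. *)
apply: le_trans (normE_pi_tilde_le v Kp rt) (wm _ _).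
by rewrite lexx.
Qed.

(** The pointwise comparisons pass to the suprema, since [Pi r p] stays in [K]. *)
Lemma lambda_eq : lambda sigma F tau K = lambda_tilde sigma F tau K.
Proof.
apply/eqP; rewrite eq_le; apply/andP; split.
  apply: ge_ereal_sup => _ [p Kp <-].
  apply: le_trans (lambda_s_le Kp) _.
  by apply: ereal_sup_ubound; exists p.
apply: ge_ereal_sup => _ [p Kp <-].
apply: le_trans (lambda_tilde_s_le Kp) _.
by apply: ereal_sup_ubound; exists (Pi r p) => //; apply: Pi_in => //; exact: ltW.
Qed.

End nonlinear_semiflow.

Theorem theorem3p10 (R : realType) (r : R) (r_gt0 : 0 < r)
    (n : nat) (n_ge1 : (1 <= n)%N) (N : rVnorm R n)
    (Omega : metricType R) (Omega_compact : compact [set: Omega])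
    (sigma : R -> Omega -> Omega) (sigma_flow : is_flow sigma)
    (F : Omega -> Rn N -> Rn N -> Rn N)
    (tau : Omega -> segC r (Rn N) -> R)
    (tau_range : forall w x, 0 <= tau w x <= r)
    (hF : H1 F) (htau : H2_1 tau)
    (K : set (Omega * segW r (Rn N)))
    (K_compact : compact K)
    (K_invariant : positively_invariant sigma F tau K)
    (K_backward : forall p, K p -> backward_extension sigma F tau K p) :
  [/\ (forall t p, r <= t -> K p ->
        (opnorm normW normW (pi_L sigma F tau t p) <=
         (1 + C0 F tau K) *
         ereal_sup [set opnorm normE normE (pi_tilde sigma F tau (t + s)%R p)
                   | s in `[(- r)%R, 0%R]])%E),
      (forall p, K p ->
        (lambda_s sigma F tau p <= lambda_tilde_s sigma F tau p)%E),
      (forall t p, r <= t -> K p ->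
        (opnorm normE normE (pi_tilde sigma F tau t p) <=
         hatC sigma F tau K *
         opnorm normW normW (pi_L sigma F tau (t - r)%R (Pi sigma F tau r p)))%E),
      (forall p, K p ->
        (lambda_tilde_s sigma F tau p <=
         lambda_s sigma F tau (Pi sigma F tau r p))%E) &
      lambda sigma F tau K = lambda_tilde sigma F tau K].
Proof.
split.
- by move=> t p rt Kp; exact:
    (opnorm_pi_L_le r_gt0 Omega_compact tau_range hF htau K_compact
    K_invariant K_backward rt Kp).
- by move=> p Kp; exact: (lambda_s_le r_gt0 Omega_compact tau_range hF htau K_compact
    K_invariant K_backward Kp).
- by move=> t p rt Kp; exact:
    (opnorm_pi_tilde_le r_gt0 Omega_compact sigma_flow tau_range hF htau K_compact
    K_invariant K_backward rt Kp).
- by move=> p Kp; exact: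
    (lambda_tilde_s_le r_gt0 Omega_compact sigma_flow tau_range hF htau K_compact
    K_invariant K_backward Kp).
- exact: (lambda_eq r_gt0 Omega_compact sigma_flow tau_range hF htau K_compact
    K_invariant K_backward).
Qed.
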